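(* Let $\Gamma$ be a metric graph of genus $g$. The set $\Sigma$ of break divisors on $\Gamma$ is equal to the closure, in $\operatorname{Div}^g_+(\Gamma)$, of the set of universally reduced divisors on $\Gamma$.
   Context: A metric graph $\Gamma$ arises from a weighted graph model $G$ (finite connected graph without loops, positive edge lengths) by gluing segments; genus $g=|E(G)|-|V(G)|+1$. $\operatorname{Div}^g_+(\Gamma)$ is the set of effective divisors of degree $g$, identified with the symmetric product $\Gamma^g/S_g$ and given the quotient topology. A break divisor is a divisor $(p_1)+\cdots+(p_g)$ such that, for some model $G$ and spanning tree $T$ of $G$ with complementary edges $e_1,\dots,e_g$, $p_i$ lies in the closed edge $\bar e_i$ for each $i$. Linear equivalence: $R(\Gamma)$ is the group of continuous piecewise affine integer-slope functions, $\Delta(f)=\sum_p\sigma_p(f)(p)$ with $-\sigma_p(f)$ the sum of slopes of $f$ in all tangent directions at $p$, and $D\sim D'$ iff $D-D'=\Delta(f)$. For $q\in\Gamma$, $D$ is $q$-reduced if $D(p)\ge 0$ for all $p\ne q$ and for every closed connected $X\subseteq\Gamma$ with $q\notin X$ there is $p\in\partial X$ with $D(p)$ less than the number of tangent directions at $p$ leaving $X$. A divisor is universally reduced if it has degree $g$, is effective, and is $q$-reduced for every $q\in\Gamma$. *)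

(* Defs.v *)
From HB Require Import structures.
From mathcomp Require Import all_boot all_order all_algebra perm finmap.
From mathcomp Require Import all_classical all_reals topology.
From mathcomp Require Import normedtype.
From mathcomp Require Import freeg.

Set Implicit Arguments.
Unset Strict Implicit.
Unset Printing Implicit Defensive.

Import Order.TTheory GRing.Theory Num.Theory.
Import numFieldTopology.Exports numFieldNormedType.Exports.

Local Open Scope classical_set_scope.
Local Open Scope ring_scope.

(* Parallel edges are allowed, loops are not.  [src] and [tgt] fix an arbitrary
   orientation of each edge, used only to parametrize it. *)
Record wgraph (R : realType) := WGraph {
  vertex : finType;
  edge : finType;
  src : edge -> vertex;
  tgt : edge -> vertex;
  len : edge -> R;
  len_gt0 : forall e, 0 < len e;
  src_neq_tgt : forall e, src e != tgt e;
  vertex_gt0 : (0 < #|vertex|)%N;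
  wgraph_connected : forall u v : vertex,
    connect [rel x y | [exists e, ((src e == x) && (tgt e == y))
                               || ((src e == y) && (tgt e == x))]] u v
}.

Section WGraphTheory.
Context {R : realType}.
Variable G : wgraph R.

Definition genus : nat := (#|edge G| + 1 - #|vertex G|)%N.

Definition adj (T : {set edge G}) : rel (vertex G) :=
  [rel x y | [exists e in T, ((src e == x) && (tgt e == y))
                          || ((src e == y) && (tgt e == x))]].

Definition dart : Type := (edge G * bool)%type.
Definition dart_src (d : dart) : vertex G := if d.2 then src d.1 else tgt d.1.
Definition dart_tgt (d : dart) : vertex G := if d.2 then tgt d.1 else src d.1.

Definition graph_cycle (T : {set edge G}) (c : seq dart) : bool :=
  [&& c != [::],
      all (fun d => d.1 \in T) c,
      uniq [seq d.1 | d <- c],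
      uniq [seq dart_src d | d <- c]
    & cycle [rel d d' : dart | dart_tgt d == dart_src d'] c].

Definition spanning_tree (T : {set edge G}) : Prop :=
  (forall u v, connect (adj T) u v) /\ (forall c, ~~ graph_cycle T c).

End WGraphTheory.

(* Lengths of the chains of segments joining two points of a space covered by
   the arcs [par e @` `[0, len e]]; the gluing metric is their infimum. *)
Inductive chain {R : realType} (G : wgraph R) (X : Type)
    (par : edge G -> R -> X) (x : X) : X -> R -> Prop :=
| chain_nil : chain par x x 0
| chain_step e s t l : 0 <= s <= len e -> 0 <= t <= len e ->
    chain par x (par e s) l -> chain par x (par e t) (l + `|t - s|).

(* [Gamma] is obtained from [graph] by gluing the segments [0, len e], with
   [par e] the canonical map of the segment of [e]; it is only meaningful on
   [0, len e]. *)
Record model {R : realType} (Gamma : metricType R) := Model {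
  graph :> wgraph R;
  vtx : vertex graph -> Gamma;
  par : edge graph -> R -> Gamma;
  par_src : forall e, par e 0 = vtx (src e);
  par_tgt : forall e, par e (len e) = vtx (tgt e);
  vtx_inj : injective vtx;
  vtx_notin_par : forall e s v, 0 < s < len e -> par e s <> vtx v;
  par_inj : forall e s e' s', 0 < s < len e -> 0 < s' < len e' ->
    par e s = par e' s' -> e = e' /\ s = s';
  model_cover : forall x : Gamma,
    (exists v, x = vtx v) \/ (exists e s, 0 < s < len e /\ x = par e s);
  model_mdist : forall x y : Gamma,
    mdist x y = inf [set l | chain par x y l]
}.

Definition closed_edge {R : realType} (Gamma : metricType R) (G : model Gamma)
    (e : edge G) : set Gamma :=
  [set par e s | s in [set s | 0 <= s <= len e]].

Definition metric_graph {R : realType} (Gamma : metricType R) (g : nat) : Prop :=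
  exists G : model Gamma, genus G = g.

Definition effective {T : choiceType} (D : {freeg T}) : bool := fgle 0 D.

Definition effdiv (T : choiceType) (g : nat) : Type :=
  {D : {freeg T} | effective D && (deg D == g%:Z)}.

HB.instance Definition _ (T : choiceType) g := SubChoice.on (effdiv T g).

Section EffDivQuotient.
Variables (T : choiceType) (g : nat).

Lemma effective_sum (I : Type) (r : seq I) (P : pred I) (F : I -> {freeg T}) :
  (forall i, P i -> effective (F i)) -> effective (\sum_(i <- r | P i) F i).
Proof.
move=> F0; apply/fgposP => z; rewrite raddf_sum sumr_ge0// => i Pi.
exact/fgposP/F0.
Qed.

Lemma effectiveU (x : T) : effective (<< x >> : {freeg T}).
Proof. by apply/fgposP => z; rewrite coeffU mul1r ler0n. Qed.

Lemma sum_points_subproof (p : 'I_g -> T) :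
  effective (\sum_i << p i >> : {freeg T}) &&
  (deg (\sum_i << p i >> : {freeg T}) == g%:Z).
Proof.
rewrite effective_sum/=; last by move=> i _; exact: effectiveU.
rewrite raddf_sum; under eq_bigr do rewrite /= degU.
by rewrite sumr_const card_ord natz.
Qed.

Definition sum_points (p : 'I_g -> T) : effdiv T g :=
  Sub (\sum_i << p i >>) (sum_points_subproof p).

Lemma sum_points_surj (D : effdiv T g) : exists p, sum_points p = D.
Proof.
case: D => D Dg; have /andP[/fgposP D0 /eqP degD] := Dg.
pose s := flatten [seq nseq `|coeff z D|%N z | z <- dom D].
have sD : \sum_(x <- s) << x >> = D.
  rewrite /s big_flatten/= big_map -[RHS]freeg_sumE; apply: eq_bigr => z _.
  apply/eqP/freeg_eqP => y; rewrite big_nseq iter_addr addr0.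
  by rewrite raddfMn/= !coeffU -mulrnAl (natz (absz _)) gez0_abs.
have szs : size s == g.
  rewrite -eqz_nat -degD -sD raddf_sum; under eq_bigr do rewrite /= degU.
  by rewrite big_const_seq count_predT iter_addr addr0 natz.
exists (tnth (Tuple szs)); apply: val_inj => /=.
by rewrite -[RHS]sD -(big_tuple _ _ (Tuple szs) xpredT (fun x => << x >>)).
Qed.

(* The fibres of [sum_points] are the orbits of the symmetric group, so that
   [effdiv T g] is the symmetric product. *)
Lemma sum_points_fibre (p p' : 'I_g -> T) :
  sum_points p = sum_points p' <-> exists s : 'S_g, p' = p \o s.
Proof.
split=> [/(congr1 val)/= pp'|[s ->]]; last first.
  by apply: val_inj => /=; rewrite (reindex_inj (@perm_inj _ s)).
have cnt (q : 'I_g -> T) z :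
    coeff z (\sum_i << q i >> : {freeg T}) =
    (count_mem z [tuple q i | i < g])%:Z.
  rewrite raddf_sum; under eq_bigr do rewrite /= coeffU mul1r.
  rewrite -natr_sum natz; congr Posz.
  rewrite -sum1_count big_tuple [RHS]big_mkcond /=.
  by apply: eq_bigr => i _; rewrite tnth_mktuple; case: eqP.
have /tuple_permP[s es] : perm_eq [tuple p' i | i < g] [tuple p i | i < g].
  apply/allP => z _ /=; apply/eqP.
  by have [] : (count_mem z [tuple p' i | i < g])%:Z =
               (count_mem z [tuple p i | i < g])%:Z by rewrite -!cnt pp'.
exists s; apply/funext => i /=.
have := congr1 (fun t : g.-tuple T => tnth t i) (val_inj es).
by rewrite !tnth_mktuple.
Qed.

Definition some_points (D : effdiv T g) : 'I_g -> T :=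
  projT1 (cid (sum_points_surj D)).

Lemma some_pointsK : cancel some_points sum_points.
Proof. by move=> D; exact: projT2 (cid (sum_points_surj D)). Qed.

HB.instance Definition _ :=
  isQuotient.Build ('I_g -> T) (effdiv T g) some_pointsK.

End EffDivQuotient.

(* The effective divisors of degree [g], with the quotient topology of the
   product topology along [sum_points]. *)
Definition Divplus (T : topologicalType) (g : nat) : topologicalType :=
  quotient_topology (effdiv T g : quotType ({ptws 'I_g -> T})).

Lemma open_DivplusE (T : topologicalType) (g : nat) (U : set (Divplus T g)) :
  open U = open ([set p | U (sum_points p)] : set {ptws 'I_g -> T}).
Proof. by rewrite [LHS]/open/= /quotient_open pi.unlock. Qed.

Definition divisor {T : topologicalType} {g : nat} (D : Divplus T g) :
  {freeg T} := sval (D : effdiv T g).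

Definition break_divisor {R : realType} {Gamma : metricType R}
    (D : {freeg Gamma}) : Prop :=
  exists (G : model Gamma) (T : {set edge G}) (p : edge G -> Gamma),
    [/\ spanning_tree T,
        forall e, e \notin T -> closed_edge e (p e)
      & D = \sum_(e | e \notin T) << p e >>].

Section Reduced.
Context {R : realType}.
Variable Gamma : metricType R.
Implicit Types (p q : Gamma) (X : set Gamma) (D : {freeg Gamma}).

(* Unit speed parametrizations of segments issuing from [p]; two of them define
   the same tangent direction when they agree near 0. *)
Definition emanating p : set (R -> Gamma) :=
  [set gam | gam 0 = p /\ exists2 eps : R, 0 < eps &
    forall s t, 0 <= s <= eps -> 0 <= t <= eps ->
      mdist (gam s) (gam t) = `|s - t|].

Definition same_direction (gam gam' : R -> Gamma) : Prop :=
  \forall t \near (0 : R)^'+, gam t = gam' t.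

Definition tangent_directions p : set (set (R -> Gamma)) :=
  [set emanating p `&` same_direction gam | gam in emanating p].

Definition leaves X (v : set (R -> Gamma)) : Prop :=
  forall gam, v gam -> \forall t \near (0 : R)^'+, ~ X (gam t).

Definition outdeg X p : nat :=
  #|` fset_set [set v | tangent_directions p v /\ leaves X v] |%fset.

Definition boundary X : set Gamma := closure X `\` X°.

Definition q_reduced q D : Prop :=
  (forall p, p <> q -> 0 <= coeff p D) /\
  (forall X, X !=set0 -> closed X -> connected X -> ~ X q ->
     exists2 p, boundary X p & coeff p D < (outdeg X p)%:Z).

Definition universally_reduced (g : nat) D : Prop :=
  [/\ deg D = g%:Z, effective D & forall q, q_reduced q D].

End Reduced.

(* Main.v *)
(* Universally reduced divisors are break divisors of every fixed model G.
   Firing the segment between two chips of an open edge shows that such an edge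
   carries at most one chip.  Let K be the set of edges without interior chip.
   For a set A of vertices spanning a connected subgraph, fire the edges inside
   A and the part up to the chip of the edges leaving A: some v in A has fewer
   chips than K-edges leaving A, which is Dhar's criterion for (V, K).  As it
   holds for every base vertex, the chips of any proper A, plus #|A|, number at
   most the K-edges touching A, so Hakimi's theorem orients K with indegree
   D(v) + 1 at v <> q and D(q) at q.  All vertices are reachable from q, and an
   arborescence rooted at q is the required spanning tree.  For fixed G the
   break divisors form a closed set, a finite union of images of products of
   closed edges.

   Conversely, moving each p_i into the interior of its edge approximates a
   break divisor by one with support S such that Gamma minus S is connected.
   If D >= outdeg_X on the boundary of X, then the boundary lies in S, so X
   contains Gamma minus S or is contained in S; in the first case X is Gamma, in
   the second X leaves each of its points in two directions, against D = 1. *)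
Require Import Defs.
From HB Require Import structures.
From mathcomp Require Import all_boot all_order all_algebra perm finmap.
From mathcomp Require Import all_classical all_reals topology normedtype.
From mathcomp Require Import freeg.
From mathcomp Require Import zify ring lra.

Set Implicit Arguments.
Unset Strict Implicit.
Unset Printing Implicit Defensive.

Import Order.TTheory GRing.Theory Num.Theory.
Import numFieldTopology.Exports numFieldNormedType.Exports.

Local Open Scope ring_scope.

(** * Orientations of finite graphs *)

Section Orientation.
Import mathcomp.boot.finset.
Variables (V E : finType) (s t : E -> V).
Implicit Types (K : {set E}) (A : {set V}).

Definition touching K A : nat := \sum_(e in K) ((s e \in A) || (t e \in A)).

Lemma touchingD1 K e A : e \in K ->
  touching K A = ((s e \in A) || (t e \in A) + touching (K :\ e) A)%N.
Proof. by move=> eK; rewrite /touching (big_setD1 e). Qed.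

(** Submodularity holds edge by edge; it serves as the uncrossing inequality in
    [orientation_of_indegrees]. *)
Lemma touching_submod K (A B : {set V}) :
  (touching K (A :|: B) + touching K (A :&: B) <= touching K A + touching K B)%N.
Proof.
rewrite /touching -!big_split/=; apply: leq_sum => e _; rewrite !inE.
by do 4 case: (_ \in _).
Qed.

(** Hakimi's theorem, by induction on the number of edges: an edge [e] is removed and the demand of
    one of its ends lowered by one. Uncrossing shows that one of the two ends preserves the
    inequalities. *)
Lemma orientation_of_indegrees K (d : V -> int) :
    (forall A, \sum_(v in A) d v <= (touching K A)%:Z) ->
    \sum_v d v = #|K|%:Z ->
  exists h : E -> V, (forall e, e \in K -> h e = s e \/ h e = t e) /\
    forall v, #|[set e in K | h e == v]|%:Z = d v.
Proof.
move nK : #|K| => n; elim: n K nK d => [|n IH] K nK d dle dK.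
  have K0 : K = set0 by apply/eqP; rewrite -cards_eq0 nK.
  have d0 v : d v <= 0.
    by have := dle [set v]; rewrite big_set1 /touching K0 big_set0.
  exists s; split=> [e|v]; first by rewrite K0 inE.
  have -> : [set e in K | s e == v] = set0 by apply/setP => e; rewrite K0 !inE.
  rewrite cards0; apply/esym/eqP; rewrite -oppr_eq0; apply/eqP.
  have /psumr_eq0P -> // : \sum_v - d v = 0 by rewrite sumrN dK oppr0.
  by move=> i _; rewrite oppr_ge0.
have [e eK] : exists e, e \in K by apply/set0Pn; rewrite -cards_eq0 nK.
have nKe : #|K :\ e| = n by have := cardsD1 e K; rewrite eK nK => -[].
pose dec (u v : V) : int := d v - (v == u)%:Z.
have sumdec u A : \sum_(v in A) dec u v = \sum_(v in A) d v - (u \in A)%:Z.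
  rewrite sumrB; congr (_ - _); have [uA|uA] := boolP (u \in A).
    by rewrite (big_setD1 u)//= eqxx big1 ?addr0// => v; rewrite !inE => /andP[/negbTE->].
  by rewrite big1// => v vA; case: eqP => // vu; rewrite -vu vA in uA.
have step u : (u = s e \/ u = t e) ->
    (forall A, \sum_(v in A) dec u v <= (touching (K :\ e) A)%:Z) ->
  exists h : E -> V, (forall e, e \in K -> h e = s e \/ h e = t e) /\
    forall v, #|[set e in K | h e == v]|%:Z = d v.
  move=> ue uA; have [|h [hK hd]] := IH _ nKe _ uA.
    have sT f : \sum_(v in [set: V]) f v = \sum_v f v :> int.
      by apply: eq_bigl => v; rewrite inE.
    by have := sumdec u [set: V]; rewrite !sT dK inE => ->; lia.
  exists (fun f => if f == e then u else h f); split=> [f fK|v].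
    by case: (eqVneq f e) => [->//|fe]; apply: hK; rewrite !inE fe.
  rewrite (cardsD1 e) !inE eK eqxx/=.
  have -> : [set f in K | (if f == e then u else h f) == v] :\ e =
            [set f in K :\ e | h f == v].
    by apply/setP => f; rewrite !inE; case: (f == e) => //=.
  by have := hd v; rewrite /dec (eq_sym v u); case: (u == v) => /=; lia.
have [ok|/existsNP[A nA]] := pselect (forall A, \sum_(v in A) dec (s e) v <= (touching (K :\ e) A)%:Z).
  by apply: step ok; left.
have [ok|/existsNP[B nB]] := pselect (forall A, \sum_(v in A) dec (t e) v <= (touching (K :\ e) A)%:Z).
  by apply: step ok; right.
(* A violation at [A] forces [s e] outside [A], [t e] inside, and equality for [A] and [K];
   symmetrically for [B]. The union contains both ends of [e] and the intersection neither, against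
   submodularity. *)
exfalso; move: nA nB; rewrite !sumdec.
have := touching_submod (K :\ e) A B.
have := dle A; have := dle B; have := dle (A :|: B); have := dle (A :&: B).
rewrite !(touchingD1 _ eK) !inE.
have : \sum_(v in A :|: B) d v + \sum_(v in A :&: B) d v =
       \sum_(v in A) d v + \sum_(v in B) d v.
  rewrite !(big_mkcond (fun v => v \in _))/= -!big_split/=; apply: eq_bigr => v _.
  by rewrite !inE; case: (v \in A); case: (v \in B) => /=; rewrite ?addr0 ?add0r.
move: (\sum_(v in A) _) (\sum_(v in B) _) (\sum_(v in A :|: B) _) (\sum_(v in A :&: B) _).
move: (touching _ A) (touching _ B) (touching _ (A :|: B)) (touching _ (A :&: B)).
by case: (s e \in A); case: (t e \in A); case: (s e \in B); case: (t e \in B) => /=; lia.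
Qed.

Definition exits K A v : {set E} :=
  [set e in K | ((s e == v) && (t e \notin A)) || ((t e == v) && (s e \notin A))].

(* This is Dhar's burning order, read from its last vertex. *)
Lemma dhar_touching K (d : V -> nat) :
    (forall A : {set V}, A != set0 -> A != [set: V] ->
       exists2 v, v \in A & (d v < #|exits K A v|)%N) ->
  forall A : {set V}, A != [set: V] -> (\sum_(v in A) (d v).+1 <= touching K A)%N.
Proof.
move=> dhar A; move nA : #|A| => n; elim: n A nA => [|n IH] A nA AT.
  by rewrite (_ : A = set0) ?big_set0//; apply/eqP; rewrite -cards_eq0 nA.
have A0 : A != set0 by rewrite -cards_eq0 nA.
have [v vA dv] := dhar _ A0 AT.
rewrite (big_setD1 v)//=.
have /IH : #|A :\ v| = n by have := cardsD1 v A; rewrite vA nA => -[].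
have AvT : A :\ v != [set: V].
  by apply/negP => /eqP/setP/(_ v); rewrite !inE eqxx.
move=> /(_ AvT) IHv; apply: leq_trans (leq_add dv IHv) _.
(* The edges leaving [A] at [v] touch [A] but not [A :\ v], so the two counts concern disjoint sets
   of edges. *)
rewrite -sum1_card /touching (big_mkcond (fun e => e \in exits _ _ _))/=.
rewrite (big_mkcond (fun e => e \in K))/= -big_split/= [leqRHS]big_mkcond/=.
apply: leq_sum => e _; rewrite !inE; case: (e \in K) => //=.
case: (eqVneq (s e) v) => [->|sv]; case: (eqVneq (t e) v) => [->|tv] /=; rewrite ?vA ?orbT ?andbF//=.
all: by rewrite ?orbF; case: (_ \in A).
Qed.

End Orientation.

(** * Spanning trees from Dhar's criterion *)

Section BreakOfDhar.
Import mathcomp.boot.finset.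
Context {R : realType}.
Variable G : wgraph R.
Implicit Types (K T : {set edge G}).

(** An arborescence given by parents: [h e] is the child and [o e] the parent. Parents lead down to
    the root [q], and a vertex has only one parent edge, which excludes cycles. *)
Lemma tree_of_depth T (q : vertex G) (dep : vertex G -> nat)
    (h o : edge G -> vertex G) :
    (forall e, (h e = src e /\ o e = tgt e) \/ (h e = tgt e /\ o e = src e)) ->
    {in T &, injective h} ->
    (forall e, e \in T -> (dep (o e) < dep (h e))%N) ->
    (forall v, v != q -> exists2 e, e \in T & h e = v) ->
  spanning_tree T.
Proof.
move=> ho hinj hdep hex.
have adjC : symmetric (adj T).
  by move=> x y; apply: eq_existsb => e /=; rewrite orbC.
have ad e : e \in T -> adj T (h e) (o e).
  move=> eT; apply/existsP; exists e; rewrite eT /=.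
  by case: (ho e) => -[-> ->]; rewrite !eqxx ?orbT.
have toq v : connect (adj T) v q.
  move: {2}(dep v) (leqnn (dep v)) => n; elim: n v => [|n IH] v dv.
    case: (eqVneq v q) => [->//|/hex[e /hdep]] => /[swap] ->.
    by case: (dep v) dv.
  case: (eqVneq v q) => [->//|/hex[e eT hv]].
  have := hdep _ eT; rewrite hv => od.
  apply: (@connect_trans _ _ (o e)).
    by apply: connect1; have := ad _ eT; rewrite hv.
  by apply: IH; rewrite -ltnS (leq_trans od).
split=> [u v|c].
  apply: (connect_trans (toq u)); rewrite (sym_connect_sym adjC); exact: toq.
(* The two edges of a cycle at its deepest vertex both lead to the parent. *)
apply/negP => /and5P[c0 /allP cT ue us cyc].
have [d0 d0c] : exists d, d \in c by case: c c0 {cT ue us cyc} => // d c _; exists d; rewrite inE eqxx.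
case: (arg_maxnP (P := fun d => d \in c) (fun d => dep (dart_src d)) d0c) => d dc dmx.
have {}dmx x : x \in c -> (dep (dart_src x) <= dep (dart_src d))%N by move=> /dmx.
have dh (x : dart G) : dart_src x != dart_tgt x.
  by rewrite /dart_src /dart_tgt; case: x.2; rewrite ?src_neq_tgt// eq_sym src_neq_tgt.
have dho (x : dart G) : (h x.1 = dart_src x /\ o x.1 = dart_tgt x) \/
    (h x.1 = dart_tgt x /\ o x.1 = dart_src x).
  by rewrite /dart_src /dart_tgt; case: x.2; case: (ho x.1); tauto.
have depT (x : dart G) : x \in c -> (dep (o x.1) < dep (h x.1))%N.
  by move=> /cT/hdep.
pose d' := prev c d.
have d'c : d' \in c by rewrite mem_prev.
have d'd : dart_tgt d' = dart_src d by apply/eqP; exact: (prev_cycle cyc dc).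
have nd'c : next c d \in c by rewrite mem_next.
have dnd : dart_tgt d = dart_src (next c d) by apply/eqP; exact: (next_cycle cyc dc).
have hd : h d.1 = dart_src d.
  case: (dho d) => -[]// e1 e2; have := depT _ dc; rewrite e1 e2 dnd ltnNge dmx//.
have hd' : h d'.1 = dart_src d.
  case: (dho d') => -[] e1 e2; last by rewrite e1.
  by have := depT _ d'c; rewrite e1 e2 d'd ltnNge dmx.
have edd' : d.1 = d'.1 by apply: hinj (cT _ dc) (cT _ d'c) _; rewrite hd hd'.
(* A cycle does not repeat edges, so [d] is its own predecessor and its edge would be a loop. *)
have ddd' : d = d'.
  have /(uniqP d.1) inj := ue.
  rewrite -[LHS](nth_index d dc) -[RHS](nth_index d d'c); congr (nth d c _).
  apply: inj; rewrite ?inE ?size_map ?index_mem//.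
  by rewrite !(nth_map d) ?index_mem// !nth_index.
by have := dh d'; rewrite d'd ddd' eqxx.
Qed.

(** In an orientation of [K] with indegree [d v + 1] at [v != q] and [d q] at the root [q], the
    arborescence uses one incoming edge at each [v != q]. The edges left over with head [v] then
    number [d v], one for each chip at [v]. *)
Lemma break_of_dhar K (d : vertex G -> nat) :
    (#|K|.+1 = \sum_v d v + #|vertex G|)%N ->
    (forall A : {set vertex G}, A != set0 -> A != [set: _] ->
       exists2 v, v \in A & (d v < #|exits (@src _ G) (@tgt _ G) K A v|)%N) ->
  exists T (h : edge G -> vertex G),
    [/\ spanning_tree T, T \subset K,
        forall e, h e = src e \/ h e = tgt e
      & forall v, #|[set e in K :\: T | h e == v]| = d v].
Proof.
move=> dK /dhar_touching tou; have /card_gt0P[q _] := vertex_gt0 G.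
(* The demands [d v + 1] total [#|K| + 1], one too many; the root gives one up. *)
pose d1 v : int := (d v).+1%:Z - (v == q)%:Z.
have sd1 (A : {set vertex G}) : \sum_(v in A) d1 v =
    (\sum_(v in A) (d v).+1)%:Z - (q \in A)%:Z.
  rewrite sumrB -(big_morph Posz PoszD erefl); congr (_ - _).
  have [qA|qA] := boolP (q \in A).
    by rewrite (big_setD1 q)//= eqxx big1 ?addr0// => v; rewrite !inE => /andP[/negbTE->].
  by rewrite big1// => v vA; case: eqP => // vu; rewrite -vu vA in qA.
have sT (f : vertex G -> nat) : (\sum_(v in [set: vertex G]) f v = \sum_v f v)%N.
  by apply: eq_bigl => v; rewrite inE.
have sdT : (\sum_v (d v).+1 = #|K|.+1)%N.
  rewrite dK -sum1_card -big_split/=; apply: eq_bigr => v _; lia.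
have touT : touching (@src _ G) (@tgt _ G) K [set: _] = #|K|.
  by rewrite /touching -sum1_card; apply: eq_bigr => e _; rewrite !inE.
have dle (A : {set vertex G}) : \sum_(v in A) d1 v <= (touching (@src _ G) (@tgt _ G) K A)%:Z.
  rewrite sd1; have [->|/tou] := eqVneq A [set: _]; last by case: (q \in A) => /=; lia.
  by rewrite sT sdT touT inE; lia.
have d1K : \sum_v d1 v = #|K|%:Z.
  have := sd1 [set: _]; rewrite sT sdT inE => e.
  rewrite -[RHS](_ : \sum_(v in [set: vertex G]) d1 v = _); last by rewrite e; lia.
  by apply: eq_bigl => v; rewrite inE.
have [h0 [h0K h0d]] := orientation_of_indegrees dle d1K.
pose h e := if e \in K then h0 e else src e.
pose o e := if h e == src e then tgt e else src e.
have hst e : h e = src e \/ h e = tgt e.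
  by rewrite /h; case: ifP => [/h0K//|_]; left.
have ho e : (h e = src e /\ o e = tgt e) \/ (h e = tgt e /\ o e = src e).
  rewrite /o; case: (hst e) => ->; rewrite ?eqxx; [by left|right].
  by rewrite eq_sym (negbTE (src_neq_tgt e)).
have hd v : #|[set e in K | h e == v]|%:Z = d1 v.
  rewrite -h0d; congr (Posz #|pred_of_set _|); apply/setP => e; rewrite !inE /h.
  by case: (e \in K).
pose r : rel (vertex G) := [rel u v | [exists e in K, (h e == v) && (o e == u)]].
(* A set [B] containing [q] that no oriented edge leaves receives all the edges
   touching it, one fewer than Dhar's inequality requires. *)
have reach v : connect r q v.
  pose B := [set u | connect r q u].
  suff BT : B = [set: _] by have := in_setT v; rewrite -BT inE.
  apply/eqP; apply: contraT => /tou; rewrite leqNgt => /negP[].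
  have /esym := sd1 B; rewrite inE connect0 /=.
  have -> : \sum_(v in B) d1 v = (touching (@src _ G) (@tgt _ G) K B)%:Z; last by lia.
  under eq_bigr do rewrite -hd -sum1_card.
  rewrite -(big_morph Posz PoszD erefl); congr Posz.
  rewrite (exchange_big_dep (fun e => e \in K))/=; last by move=> u e _; rewrite inE => /andP[].
  rewrite /touching; apply: eq_bigr => e eK.
  have -> : (src e \in B) || (tgt e \in B) = (h e \in B).
    have hB : o e \in B -> h e \in B.
      rewrite !inE => qo; apply: connect_trans qo (connect1 _).
      by apply/existsP; exists e; rewrite eK !eqxx.
    case: (ho e) hB => -[-> ->]; first by case: (tgt e \in B) => [->//|_]; rewrite orbF.
    by case: (src e \in B) => [->//|_].
  have [hB|hB] := boolP (h e \in B).
    rewrite (big_pred1 (h e))// => u /=; rewrite !inE eK /= (eq_sym u).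
    by case: eqP => [<-|]; rewrite ?andbF// andbT -[LHS]in_set.
  rewrite big1// => u /andP[uB]; rewrite inE eK => /eqP hu.
  by rewrite hu uB in hB.
have lenP v : exists n, `[< exists p, [/\ path r q p, last q p = v & size p = n] >].
  by have /connectP[p pp ->] := reach v; exists (size p); apply/asboolP; exists p.
pose dep v := ex_minn (lenP v).
(* The last edge of a shortest oriented path from [q] to [v] comes from a vertex of smaller
   depth. *)
have parP v : v != q -> exists2 e, e \in K & (h e == v) && (dep (o e) < dep v)%N.
  move=> vq; rewrite {2}/dep; case: ex_minnP => n /asboolP[p [+ + <-]] _.
  case/lastP: p => [_ /= qv|p w]; first by rewrite qv eqxx in vq.
  rewrite rcons_path last_rcons size_rcons => /andP[pp /existsP[e]] /[swap] ->.
  case/andP => eK /andP[/eqP he /eqP oe]; exists e => //; rewrite he eqxx ltnS /dep.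
  by case: ex_minnP => m _; apply; apply/asboolP; exists p.
pose pe v := [pick e in K | (h e == v) && (dep (o e) < dep v)%N].
have peP v e : pe v = Some e -> [/\ e \in K, h e = v & (dep (o e) < dep v)%N].
  by rewrite /pe; case: pickP => // f /andP[fK /andP[/eqP hf fd]] [<-].
pose T := [set e in K | (h e != q) && (pe (h e) == Some e)].
have TP v : v != q -> exists2 e, e \in T & h e = v.
  move=> vq; have [e0 e0K e0P] := parP _ vq.
  case E: (pe v) => [e|]; last first.
    by move: E; rewrite /pe; case: pickP => // /(_ e0); rewrite e0K e0P.
  have [eK hv _] := peP _ _ E.
  by exists e; rewrite // inE eK hv vq E eqxx.
have hT : {in T &, injective h}.
  move=> e f; rewrite !inE => /and3P[_ _ /eqP pee] /and3P[_ _ /eqP pef] hef.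
  by move: pee; rewrite hef pef => -[].
exists T, h; split=> //.
- apply: (@tree_of_depth T q dep h o ho hT _ TP) => e; rewrite inE => /and3P[_ _].
  by move=> /eqP/peP[].
- by apply/fintype.subsetP => e; rewrite inE => /andP[].
- move=> v; have := hd v; rewrite /d1.
  rewrite -(cardsID T [set e in K | h e == v]).
  have -> : [set e in K | h e == v] :\: T = [set e in K :\: T | h e == v].
    by apply/setP => e; rewrite in_setD !inE; case: (e \in K); rewrite ?andbF ?andbT /=.
  suff -> : #|[set e in K | h e == v] :&: T| = (v != q) by case: (v == q) => /=; lia.
  have [->|vq] := eqVneq v q.
    apply/eqP; rewrite cards_eq0; apply/eqP/setP => e; rewrite !inE.
    by case: (h e == q); rewrite ?andbF.
  have [e eT he] := TP _ vq; rewrite (_ : _ :&: _ = [set e]) ?cards1//.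
  apply/setP => f; rewrite !in_setI in_set1 inE.
  apply/andP/eqP => [[/andP[_ /eqP hf] fT]|->].
    by apply: hT => //; rewrite hf he.
  by rewrite eT he eqxx; move: eT; rewrite inE => /andP[->].
Qed.

End BreakOfDhar.

Local Open Scope classical_set_scope.

(** * Local structure of a metric graph *)

Section Model.
Context {R : realType} {Gamma : metricType R}.
Variable G : model Gamma.
Implicit Types (e : edge G) (d : dart G) (p x y : Gamma) (s t u eps : R).

Lemma chain_ge0 x y l : chain (@par _ _ G) x y l -> 0 <= l.
Proof. by elim=> // e s t l' _ _ _ l0; rewrite addr_ge0. Qed.

Lemma mdist_chain x y l : chain (@par _ _ G) x y l -> mdist x y <= l.
Proof.
move=> c; rewrite (model_mdist G); apply: ge_inf => //.
by exists 0 => z /=; exact: chain_ge0.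
Qed.

Lemma mdist_par e s t : 0 <= s <= len e -> 0 <= t <= len e ->
  mdist (par e s) (par e t) <= `|s - t|.
Proof.
move=> sl tl; have := mdist_chain (chain_step sl tl (chain_nil _ (par e s))).
by rewrite add0r distrC.
Qed.

Lemma par_eq e s e' s' : 0 <= s <= len e -> 0 <= s' <= len e' ->
  par e s = par e' s' ->
  (e = e' /\ s = s') \/ ((s = 0 \/ s = len e) /\ (s' = 0 \/ s' = len e')).
Proof.
have ends (f : edge G) u : 0 <= u <= len f ->
    (0 < u < len f) \/ ((u = 0 \/ u = len f) /\ exists v : vertex G, par f u = vtx v).
  move=> /andP[]; rewrite le_eqVlt => /predU1P[<- _|u0].
    by right; split; [left|exists (src f); rewrite par_src].
  rewrite le_eqVlt => /predU1P[->|ul]; last by left; rewrite u0.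
  by right; split; [right|exists (tgt f); rewrite par_tgt].
move=> /ends[si|[se [v sv]]] /ends[si'|[se' [v' sv']]] ess'.
- by left; exact: par_inj.
- by have := vtx_notin_par (v := v') si; rewrite ess' sv'.
- by have := vtx_notin_par (v := v) si'; rewrite -ess' sv.
- by right.
Qed.

(** Holds up to the ends of the segment because an edge is not a loop. *)
Lemma par_same e s s' : 0 <= s <= len e -> 0 <= s' <= len e ->
  par e s = par e s' -> s = s'.
Proof.
move=> sl sl' ess'; case: (par_eq sl sl' ess') => [[]//|[]].
have st : vtx (src e) <> vtx (tgt e) :> Gamma.
  by move=> /vtx_inj/eqP; rewrite (negbTE (src_neq_tgt e)).
move=> [] h [] h'; rewrite h h' // in ess' *.
  by rewrite par_src par_tgt in ess'; case: st.
by rewrite par_src par_tgt in ess'; case: st.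
Qed.

Lemma par_end_vtx e s : 0 <= s <= len e ->
  (s = 0 \/ s = len e) <-> exists v : vertex G, par e s = vtx v.
Proof.
move=> /andP[s0 sl]; split=> [[->|->]|[v ev]].
- by exists (src e); rewrite par_src.
- by exists (tgt e); rewrite par_tgt.
- move: s0 sl; rewrite !le_eqVlt => /predU1P[<-|s0]; first by left.
  move=> /predU1P[->|sl]; first by right.
  by have := @vtx_notin_par _ _ G e s v; rewrite s0 sl => /(_ isT).
Qed.

(** The source of lower bounds for the gluing metric: a function on [Gamma] that is 1-Lipschitz on
    each edge varies along a chain by at most its length, hence by at most the infimum. *)
Lemma lipschitz_mdist (F : edge G -> R -> R) :
    (forall e s e' s', 0 <= s <= len e -> 0 <= s' <= len e' ->
       par e s = par e' s' -> F e s = F e' s') ->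
    (forall e s t, 0 <= s <= len e -> 0 <= t <= len e ->
       `|F e s - F e t| <= `|s - t|) ->
  forall e s e' s', 0 <= s <= len e -> 0 <= s' <= len e' ->
    `|F e s - F e' s'| <= mdist (par e s) (par e' s').
Proof.
move=> Fc Fl e s e' s' sl sl'.
have cl y l : chain (@par _ _ G) (par e s) y l ->
    forall f u, 0 <= u <= len f -> par f u = y -> `|F e s - F f u| <= l.
  elim=> {y l} [f u ul eu|f u v l ul vl _ IH g w wl ew].
    by rewrite (Fc f u e s) // subrr normr0.
  rewrite (Fc g w f v)//.
  have := IH _ _ ul erefl; have := Fl f u v ul vl.
  have := ler_distD (F f u) (F e s) (F f v); rewrite (distrC v u); lra.
rewrite (model_mdist G); apply: lb_le_inf; last by move=> l /cl; apply.
(* The bound passes to the infimum only over a nonempty set; a path in [G] supplies a chain. *)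
have Gconn : exists l, chain (@par _ _ G) (par e s) (par e' s') l; last first.
  by case: Gconn => l; exists l.
have chv v w : connect [rel x y | [exists f : edge G, ((src f == x) && (tgt f == y))
    || ((src f == y) && (tgt f == x))]] v w ->
    forall l, chain (@par _ _ G) (par e s) (vtx v) l ->
    exists l', chain (@par _ _ G) (par e s) (vtx w) l'.
  move=> /connectP[q + ->]; elim: q v => [|z q IH] v /=; first by move=> _ l; exists l.
  case/andP => /existsP[f vz] zq l; have fl := ltW (len_gt0 f).
  have f0 : 0 <= (0 : R) <= len f by apply/andP.
  have fL : 0 <= len f <= len f by apply/andP.
  case/orP: vz => /andP[/eqP ef /eqP eg]; subst v z.
    by rewrite -par_src => /(chain_step f0 fL); rewrite par_tgt; exact: IH.
  by rewrite -par_tgt => /(chain_step fL f0); rewrite par_src; exact: IH.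
have e0 : 0 <= (0 : R) <= len e by apply/andP; split=> //; exact: ltW (len_gt0 _).
have e'0 : 0 <= (0 : R) <= len e' by apply/andP; split=> //; exact: ltW (len_gt0 _).
have := chain_step sl e0 (chain_nil _ (par e s)); rewrite par_src.
move=> /(chv _ _ (wgraph_connected (src e) (src e')))[l].
by rewrite -par_src => /(chain_step e'0 sl') c; exists (l + `|s' - 0|).
Qed.

Definition on_edge e x := exists2 u, 0 <= u <= len e & par e u = x.

Definition pos e x : R := xget 0 [set u | 0 <= u <= len e /\ par e u = x].

Lemma posP e x : on_edge e x -> 0 <= pos e x <= len e /\ par e (pos e x) = x.
Proof.
move=> [u ul eu]; have := @xgetPex _ 0 [set u | 0 <= u <= len e /\ par e u = x].
by apply; exists u.
Qed.

Lemma pos_par e u : 0 <= u <= len e -> pos e (par e u) = u.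
Proof.
move=> ul; have [|pl /par_same] := @posP e (par e u); first by exists u.
by apply.
Qed.

Lemma on_edge_par e u : 0 <= u <= len e -> on_edge e (par e u).
Proof. by exists u. Qed.

(** The tangent directions at [p] as darts; the flag says whether the parameter of the edge
    increases or decreases away from [p]. A point inside an edge has two. *)
Definition branches p : {set dart G} :=
  [set d | `[< on_edge d.1 p /\
               if d.2 then pos d.1 p < len d.1 else 0 < pos d.1 p >]]%SET.

Definition ray p d t : Gamma :=
  par d.1 (pos d.1 p + (if d.2 then t else - t)).

Definition star_radius p eps := 0 < eps /\ forall e, on_edge e p ->
  (0 < pos e p -> 2 * eps <= pos e p) /\
  (pos e p < len e -> pos e p + 2 * eps <= len e).

(** Every branch must have length at least [2 * eps]: the test function of [ray_dist] peaks at
    distance [eps] from [p] and is back to zero at [2 * eps]. *)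
Lemma star_radius_near p : \forall eps \near (0 : R)^'+, star_radius p eps.
Proof.
have small a b : 0 < b -> \forall eps \near (0 : R)^'+, a + 2 * eps <= a + b.
  move=> b0; near=> eps; rewrite lerD2l mulrC -ler_pdivlMr//.
  by near: eps; apply: nbhs_right_le; rewrite divr_gt0.
have all e : \forall eps \near (0 : R)^'+, on_edge e p ->
    (0 < pos e p -> 2 * eps <= pos e p) /\
    (pos e p < len e -> pos e p + 2 * eps <= len e).
  have h1 : \forall eps \near (0 : R)^'+, 0 < pos e p -> 2 * eps <= pos e p.
    have [p0|p0] := ltP 0 (pos e p); last by near=> eps.
    by near=> eps => _; rewrite -[leLHS]add0r -[leRHS]add0r; near: eps; apply: small.
  have h2 : \forall eps \near (0 : R)^'+, pos e p < len e -> pos e p + 2 * eps <= len e.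
    have [p0|p0] := ltP (pos e p) (len e); last by near=> eps.
    near=> eps => _; rewrite -[leRHS](subrK (pos e p)) [leRHS]addrC.
    by near: eps; apply: small; rewrite subr_gt0.
  by near=> eps => _; split; near: eps.
have {}all : \forall eps \near (0 : R)^'+, forall e, on_edge e p ->
    (0 < pos e p -> 2 * eps <= pos e p) /\
    (pos e p < len e -> pos e p + 2 * eps <= len e).
  exact: filter_forall.
near=> eps; split; first by near: eps; apply: nbhs_right_gt.
by near: eps.
Unshelve. all: by end_near. Qed.

Lemma end_near_pos p eps e u : star_radius p eps -> on_edge e p ->
  u = 0 \/ u = len e -> `|u - pos e p| < 2 * eps -> u = pos e p.
Proof.
move=> [eps0 sr] ep; have [s1 s2] := sr _ ep; have [/andP[p0 pl] _] := posP ep.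
move=> [->|->] h.
  apply/eqP; rewrite eq_le p0 leNgt; apply/negP => /s1.
  by move: h; rewrite sub0r normrN ger0_norm// => /lt_le_trans h /h; rewrite ltxx.
apply/eqP; rewrite eq_le pl andbT leNgt; apply/negP => /s2.
by move: h; rewrite ger0_norm ?subr_ge0//; lra.
Qed.

(** No vertex other than [p] is within reach of so short a chain, so it can change edges only at
    [p]. *)
Lemma chain_star p eps y l : star_radius p eps -> chain (@par _ _ G) p y l ->
    l < 2 * eps ->
  y = p \/ exists e u, [/\ on_edge e p, 0 <= u <= len e, par e u = y
                         & `|u - pos e p| <= l].
Proof.
move=> sr; elim=> {y l} [_|e s t l sl tl cl IH lt]; first by left.
have l2 : l < 2 * eps by apply: le_lt_trans lt; rewrite lerDl.
have atp : par e s = p -> on_edge e p /\ `|t - pos e p| <= l + `|t - s|.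
  move=> esp; have ep : on_edge e p by rewrite -esp; exact: on_edge_par.
  by split=> //; rewrite -esp pos_par// lerDr (chain_ge0 cl).
right; exists e, t; case: (IH l2) => [/atp[]//|[f [u [fp ul eu ul']]]].
case: (par_eq sl ul (esym eu)) => [[ef su]|[se ue]].
  subst f u; split=> //; have := ler_distD s t (pos e p); lra.
have up := end_near_pos sr fp ue (le_lt_trans ul' l2).
have /atp[]// : par e s = p by rewrite -eu up; have [_] := posP fp.
Qed.

Lemma branchP p d : d \in branches p ->
  on_edge d.1 p /\ if d.2 then pos d.1 p < len d.1 else 0 < pos d.1 p.
Proof. by rewrite inE => /asboolP. Qed.

Lemma ray_bound p eps d t : star_radius p eps -> d \in branches p ->
  0 <= t <= 2 * eps ->
  0 <= pos d.1 p + (if d.2 then t else - t) <= len d.1.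
Proof.
move=> [eps0 sr] /branchP[ep hd] /andP[t0 t2]; have [/andP[p0 pl] _] := posP ep.
have [h1 h2] := sr _ ep.
by case: d.2 hd => [/h2|/h1] h; apply/andP; split => /=; lra.
Qed.

Lemma ray0 p d : d \in branches p -> ray p d 0 = p.
Proof.
move=> /branchP[ep _]; have [_ e] := posP ep.
by rewrite /ray; case: d.2; rewrite ?oppr0 addr0.
Qed.

(** A distance to [p], folded back at [eps] so as to vanish before the far ends of the edges. *)
Let tent eps t : R := Num.max 0 (Num.min t (2 * eps - t)).

Let tent_cases eps t : [\/ tent eps t = 0 /\ t <= 0,
  tent eps t = 0 /\ 2 * eps <= t, tent eps t = t /\ 0 <= t /\ t <= eps
  | tent eps t = 2 * eps - t /\ eps <= t /\ t <= 2 * eps].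
Proof.
rewrite /tent; have [m1|m1] := leP t (2 * eps - t).
  have [m2|m2] := leP 0 t; [apply: Or43|apply: Or41]; split=> //; lra.
have [m2|m2] := leP 0 (2 * eps - t); [apply: Or44|apply: Or42]; split=> //; lra.
Qed.

Let tent_lip eps s t : `|tent eps s - tent eps t| <= `|s - t|.
Proof.
rewrite ler_norml; case: (ger0P (s - t)) => st; apply/andP; split;
case: (tent_cases eps s) => h; case: (tent_cases eps t) => h'; lra.
Qed.

Let tent_le eps t : 0 <= t -> 0 <= tent eps t <= t.
Proof. by move=> t0; apply/andP; split; case: (tent_cases eps t) => h; lra. Qed.

Let tentE eps t : 0 <= t <= eps -> tent eps t = t.
Proof. by move=> /andP[t0 te]; case: (tent_cases eps t) => h; lra. Qed.

Let tent0 eps t : t = 0 \/ 2 * eps <= t -> tent eps t = 0.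
Proof. by move=> [->|te]; [case: (tent_cases eps 0)|case: (tent_cases eps t)] => h; lra. Qed.

(** The upper bound follows the edge or passes through [p]. For the lower bound, the test function
    is the distance to [p], cut off by [tent], with sign plus on [d] and minus on all other
    branches. *)
Lemma ray_dist p eps d d' t t' : star_radius p eps ->
    d \in branches p -> d' \in branches p -> 0 <= t <= eps -> 0 <= t' <= eps ->
  mdist (ray p d t) (ray p d' t') = if d == d' then `|t - t'| else t + t'.
Proof.
move=> sr db db' tl tl'; have [eps0 _] := sr.
have tl2 : 0 <= t <= 2 * eps by case/andP: tl => ? ?; apply/andP; split; lra.
have tl2' : 0 <= t' <= 2 * eps by case/andP: tl' => ? ?; apply/andP; split; lra.
have [rb rb'] := (ray_bound sr db tl2, ray_bound sr db' tl2').
have l2 : 0 <= (0 : R) <= 2 * eps by apply/andP; split=> //; lra.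
apply/eqP; rewrite eq_le; apply/andP; split.
  case: eqP => [dd'|_].
    subst d'; apply: le_trans (mdist_par rb rb') _.
    by case: d.2; rewrite opprD addrACA subrr add0r// -opprD normrN.
  apply: le_trans (metric_triangle _ p _) _; rewrite lerD//.
    rewrite -[X in mdist _ X](ray0 db).
    apply: le_trans (mdist_par rb (ray_bound sr db l2)) _.
    have /andP[t0 _] := tl; rewrite opprD addrACA subrr add0r.
    by case: d.2; rewrite !oppr0 addr0 ?normrN ger0_norm.
  rewrite -[X in mdist X _](ray0 db').
  apply: le_trans (mdist_par (ray_bound sr db' l2) rb') _.
  have /andP[t0 _] := tl'; rewrite opprD addrACA subrr add0r.
  by case: d'.2; rewrite ?oppr0 sub0r !normrN ger0_norm.
pose sg (x : dart G) : R := if x == d then 1 else -1.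
pose F e u : R := if `[< on_edge e p >] then
  sg (e, pos e p < u) * tent eps `|u - pos e p| else 0.
(* Vanishing at the ends of all edges makes [F] compatible with the gluing. *)
have F_end e u : 0 <= u <= len e -> u = 0 \/ u = len e -> F e u = 0.
  move=> ul ue; rewrite /F; case: asboolP => // ep.
  rewrite tent0 ?mulr0//; have [up|up] := ltP `|u - pos e p| (2 * eps); [left|by right].
  by rewrite -(end_near_pos sr ep ue up) subrr normr0.
have sg1 (x : dart G) : `|sg x| = 1 by rewrite /sg; case: ifP; rewrite ?normrN normr1.
have Fc e u e' u' : 0 <= u <= len e -> 0 <= u' <= len e' ->
    par e u = par e' u' -> F e u = F e' u'.
  move=> ul ul' /(par_eq ul ul')[[-> ->]//|[ue ue']].
  by rewrite !F_end.
have Fl e u v : 0 <= u <= len e -> 0 <= v <= len e -> `|F e u - F e v| <= `|u - v|.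
  move=> ul vl; rewrite /F; case: asboolP => // ep; last by rewrite subrr normr0.
  (* On opposite sides of [c] the distances to [c] add up to [b - a], so the signs do not matter. *)
  have opp a b c : a <= c -> c <= b ->
      `|sg (e, c < a) * tent eps `|a - c| - sg (e, c < b) * tent eps `|b - c| | <= `|a - b|.
    move=> ac cb; apply: le_trans (ler_normB _ _) _; rewrite !normrM !sg1 !mul1r.
    have := tent_le eps (normr_ge0 (a - c)); have := tent_le eps (normr_ge0 (b - c)).
    have -> : `|a - c| = c - a by rewrite distrC ger0_norm ?subr_ge0.
    have -> : `|b - c| = b - c by rewrite ger0_norm ?subr_ge0.
    have -> : `|a - b| = b - a by rewrite distrC ger0_norm ?subr_ge0 ?(le_trans ac).
    by move=> /andP[h1 h2] /andP[h3 h4]; rewrite !ger0_norm//; lra.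
  have [vp|vp] := leP v (pos e p); have [up|up] := leP u (pos e p).
  - rewrite -mulrBr normrM sg1 mul1r; apply: le_trans (tent_lip _ _ _) _.
    apply: le_trans (ler_dist_dist _ _) _; rewrite opprB addrA subrK; lra.
  - by have := opp _ _ _ vp (ltW up); rewrite ltNge vp /= up distrC [X in _ <= X]distrC.
  - by have := opp _ _ _ up (ltW vp); rewrite ltNge up /= vp.
  - rewrite -mulrBr normrM sg1 mul1r; apply: le_trans (tent_lip _ _ _) _.
    by apply: le_trans (ler_dist_dist _ _) _; rewrite opprB addrA subrK.
have Fray (x : dart G) w : x \in branches p -> 0 <= w <= eps ->
    F x.1 (pos x.1 p + (if x.2 then w else - w)) = sg x * w.
  move=> /branchP[xp hx] wl; rewrite /F asboolT// addrAC subrr add0r.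
  have -> : `|if x.2 then w else - w| = w.
    by case/andP: wl => ? _; case: x.2; rewrite ?normrN ger0_norm.
  rewrite tentE//; case: (eqVneq w 0) => [->|w0]; first by rewrite !mulr0.
  have wp : 0 < w by case/andP: wl => ? _; rewrite lt_neqAle eq_sym w0.
  congr (sg _ * _); case: x {hx xp} => e [] /=.
    by rewrite ltrDl wp.
  by rewrite ltrDl oppr_gt0 ltNge ltW.
have := lipschitz_mdist Fc Fl rb rb'; rewrite !Fray// => /(le_trans _); apply.
rewrite /sg eqxx mul1r (eq_sym d'); case: eqP => _; rewrite ?mul1r//.
by rewrite mulN1r opprK ler_norm.
Qed.

Lemma mdist_ray p eps d t : star_radius p eps -> d \in branches p -> 0 <= t <= eps ->
  mdist p (ray p d t) = t.
Proof.
move=> sr db tl; have [eps0 _] := sr.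
have := @ray_dist _ _ _ _ 0 t sr db db; rewrite ray0// eqxx sub0r normrN => -> //.
  by rewrite ger0_norm//; case/andP: tl.
by rewrite lexx ltW.
Qed.

(** A small ball is a star: some chain to [x] is shorter than [eps], which puts [x] on a branch, and
    [mdist_ray] identifies its parameter. *)
Lemma star_ball p eps x : star_radius p eps -> mdist p x < eps -> x <> p ->
  exists2 d, d \in branches p & x = ray p d (mdist p x).
Proof.
move=> sr px xp; have [eps0 _] := sr.
have [l c lx] : exists2 l, chain (@par _ _ G) p x l & l < eps.
  apply: contrapT => nl; have npx : ~ (p = x) by move/esym.
  move: px; rewrite ltNge => /negP[].
  have [[l cl]|nc] := pselect (exists l, chain (@par _ _ G) p x l).
    rewrite (model_mdist G); apply: lb_le_inf; first by exists l.
    by move=> m cm /=; rewrite leNgt; apply/negP => mx; apply: nl; exists m.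
  (* Without chains the infimum takes its default value 0, which would give [p = x]. *)
  exfalso; apply: npx; apply: mdist_positivity.
  rewrite (model_mdist G) (_ : [set l | _] = set0) ?inf0//.
  by apply/seteqP; split=> // l cl; apply: nc; exists l.
have l2 : l < 2 * eps by lra.
case: (chain_star sr c l2) => // -[e [u [ep ul eu ule]]].
have ne : u != pos e p.
  by apply/eqP => ue; apply: xp; rewrite -eu ue; have [_] := posP ep.
pose d : dart G := (e, pos e p < u).
have [pl epp] := posP ep; case/andP: ul => u0 ul.
have db : d \in branches p.
  rewrite inE /d; apply/asboolP; split=> //=; move: ne; rewrite neq_lt.
  case: (ltgtP u (pos e p)) => // pu _; first exact: (le_lt_trans u0).
  exact: (lt_le_trans pu).
have xd : x = ray p d `|u - pos e p|.
  rewrite -eu /ray /=; congr par; case: ltP => pu.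
    by rewrite gtr0_norm ?subr_gt0// addrC subrK.
  by rewrite ler0_norm ?subr_le0// opprK addrC subrK.
exists d => //; rewrite {2}xd (mdist_ray sr db)//.
by rewrite normr_ge0 /= (le_trans ule)// ltW.
Qed.

End Model.

Lemma near_right0P {R : realType} (P : R -> Prop) :
  (\forall t \near (0 : R)^'+, P t) <->
  exists2 r : R, 0 < r & forall t, 0 < t -> t < r -> P t.
Proof.
split=> [[r /= r0 rP]|[r r0 rP]].
  exists r => // t t0 tr; apply: rP => //=.
  by rewrite sub0r normrN gtr0_norm.
exists r => //= t /=; rewrite sub0r normrN => tr t0; apply: rP => //.
by rewrite -[ltLHS]gtr0_norm.
Qed.

(** * Neighbourhoods, tangent directions and boundaries along branches *)

Section LocalTopology.
Context {R : realType} {Gamma : metricType R}.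
Variable G : model Gamma.
Implicit Types (e : edge G) (d : dart G) (p x y : Gamma) (s t u a b eps : R).
Implicit Types (X : set Gamma).

Lemma star_radius_le p eps eps' : star_radius G p eps -> 0 < eps' <= eps ->
  star_radius G p eps'.
Proof.
move=> [eps0 sr] /andP[e0 ee]; split=> // e /sr[h1 h2].
by split=> [/h1|/h2]; lra.
Qed.

Lemma star_radius_ex p : exists eps, star_radius G p eps.
Proof.
have /near_right0P[r r0 h] := star_radius_near G p.
by exists (r / 2); apply: h; lra.
Qed.

Lemma nbhs_mdist p (P : set Gamma) :
  nbhs p P <-> exists2 r : R, 0 < r & forall x, mdist p x < r -> P x.
Proof.
split=> [/nbhs_ballP[r /= r0 rP]|[r r0 rP]].
  by exists r => // x px; apply: rP; rewrite ballEmdist.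
by apply/nbhs_ballP; exists r => //= x; rewrite ballEmdist; exact: rP.
Qed.

(** A small ball consists of [p] and finitely many rays, so topology at [p] reduces to conditions in
    one real variable. *)
Lemma nbhs_rayP p (P : set Gamma) : nbhs p P <->
  P p /\ forall d, d \in branches G p -> \forall t \near (0 : R)^'+, P (ray p d t).
Proof.
have [eps sr] := star_radius_ex p; have [eps0 _] := sr.
split=> [nP|[Pp Pd]].
  split=> [|d db]; first exact: nbhs_singleton.
  have /nbhs_mdist[r r0 rP] := nP; apply/near_right0P.
  exists (Num.min r eps); first by rewrite lt_min r0.
  move=> t t0; rewrite lt_min => /andP[tr te]; apply: rP.
  by rewrite (mdist_ray sr db)// !ltW.
have /near_right0P[r r0 rP] : \forall t \near (0 : R)^'+, forall d, d \in branches G p -> P (ray p d t).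
  apply: filter_forall => d; case: (boolP (d \in branches G p)) => [/Pd|db].
    by apply: filterS.
  by near=> t.
apply/nbhs_mdist; exists (Num.min r eps); first by rewrite lt_min r0.
move=> x; rewrite lt_min => /andP[xr xe].
have [->//|/eqP xp] := eqVneq x p; have [d db ->] := star_ball sr xe xp.
by apply: rP => //; rewrite mdist_gt0 eq_sym; exact/eqP.
Unshelve. all: by end_near. Qed.

Lemma emanating_ray p d : d \in branches G p -> emanating p (ray p d).
Proof.
move=> db; have [eps sr] := star_radius_ex p; have [eps0 _] := sr.
split; first exact: ray0.
by exists eps => // s t sl tl; rewrite (ray_dist sr)// eqxx.
Qed.

(** At each small time [t] the path is at distance [t] on some ray. If that ray differed from the
    one at [eps / 2], the two points would be [t + eps / 2] apart instead of [eps / 2 - t]. *)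
Lemma emanating_along_ray p (gam : R -> Gamma) : emanating p gam ->
  exists2 d, d \in branches G p & same_direction (ray p d) gam.
Proof.
move=> [g0 [r r0 giso]]; have [eps0 sr0] := star_radius_ex p.
have [eps00 _] := sr0.
have [eps er sr] : exists2 eps, eps <= r & star_radius G p eps.
  exists (Num.min r eps0); first by rewrite ge_min lexx.
  by apply: (star_radius_le sr0); rewrite lt_min r0 eps00 ge_min lexx orbT.
have [{r0 eps00}eps00 _] := sr.
have gd t : 0 < t -> t < eps -> mdist p (gam t) = t.
  move=> t0 te; rewrite -g0 giso ?sub0r ?normrN ?gtr0_norm//.
    by rewrite lexx ltW// (lt_le_trans eps00).
  by rewrite !ltW// (lt_le_trans te).
have gray t : 0 < t -> t < eps -> exists2 d, d \in branches G p & gam t = ray p d t.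
  move=> t0 te; have := star_ball sr (x := gam t); rewrite gd//; apply=> // gtp.
  by have := gd t t0 te; rewrite gtp mdistxx => t00; rewrite -t00 ltxx in t0.
have e2 : 0 < eps / 2 < eps by lra.
have /andP[e20 e21] := e2; have [d db gde] := gray _ e20 e21.
exists d => //; apply/near_right0P; exists (eps / 2) => // t t0 te.
have [|d' db' gt] := gray t t0; first by lra.
have := giso t (eps / 2); rewrite gt gde (ray_dist sr)//; last by rewrite !ltW.
  case: eqP => [->//|_]; rewrite ler0_norm ?opprB; last by lra.
  have h1 : 0 <= t <= r by apply/andP; lra.
  have h2 : 0 <= eps / 2 <= r by apply/andP; lra.
  by move=> /(_ h1 h2) h; (suff: (1 : R) <= 0 by rewrite ler10); lra.
by apply/andP; lra.
Qed.

Lemma ray_direction_inj p d d' : d \in branches G p -> d' \in branches G p ->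
  same_direction (ray p d) (ray p d') -> d = d'.
Proof.
move=> db db' /near_right0P[r r0 rP]; have [eps sr] := star_radius_ex p.
have [eps0 _] := sr; pose m := Num.min r eps / 2.
have m0 : 0 < Num.min r eps by rewrite lt_min r0.
have [mr me] : Num.min r eps <= r /\ Num.min r eps <= eps.
  by rewrite !ge_min !lexx orbT.
have mm : 0 <= m <= eps by apply/andP; rewrite /m; lra.
have := ray_dist sr db db' mm mm; rewrite rP ?mdistxx; [|rewrite /m; lra..].
by case: eqP => // _; rewrite /m => h; (suff: (1 : R) <= 0 by rewrite ler10); lra.
Qed.

(** Each tangent direction is that of exactly one branch, so the count of classes of isometric germs
    becomes a count of darts, in any model. *)
Lemma outdegE X p : outdeg X p =
  #|[set d in branches G p | `[< \forall t \near (0 : R)^'+, ~ X (ray p d t) >]]%SET|.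
Proof.
set S := [set d in _ | _]%SET.
pose dir d := emanating p `&` same_direction (ray p d).
have sd_sym (g1 g2 : R -> Gamma) : same_direction g1 g2 -> same_direction g2 g1.
  by apply: filterS => t ->.
have sd_trans (g1 g2 g3 : R -> Gamma) :
    same_direction g1 g2 -> same_direction g2 g3 -> same_direction g1 g3.
  by apply: filterS2 => t -> ->.
have sd_refl (g1 : R -> Gamma) : same_direction g1 g1 by apply: nearW.
rewrite /outdeg (_ : [set v | _] = [set` [fset dir d | d in S]%fset]); last first.
  apply/seteqP; split=> [v [[gam gp <-] lv]|v /=].
    have [d db dg] := emanating_along_ray gp.
    apply/imfsetP; exists d => /=.
      rewrite inE db; apply/asboolP; apply: lv; split; first exact: emanating_ray.
      exact: sd_sym.
    apply/seteqP; split=> g [gp' gg]; split=> //.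
      exact: sd_trans gg.
    by apply: sd_trans gg; exact: sd_sym.
  move=> /imfsetP[d /=]; rewrite inE => /andP[db /asboolP dX] ->; split.
    by exists (ray p d) => //; exact: emanating_ray.
  move=> g [_ gg]; apply: filterS2 dX gg => t + <-; exact.
rewrite set_fsetK card_in_imfset ?enum_finmemE -?cardE//=.
move=> d d' /=; rewrite [d \in _]inE [d' \in _]inE => /andP[db _] /andP[db' _] edd'.
apply: ray_direction_inj (db) (db') _.
suff [] : dir d (ray p d') by [].
rewrite edd'; split=> //; exact: emanating_ray.
Qed.

Lemma par_continuous e a b : 0 <= a -> b <= len e ->
  {within `[a, b], continuous (par e)}.
Proof.
move=> a0 bl; apply/subspace_continuousP => u; rewrite /= in_itv /= => /andP[au ub].
move=> P /nbhs_mdist[eps eps0 epsP]; rewrite /= /within /=.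
apply/nbhs_ballP; exists eps => //= v; rewrite /ball /= => uv.
rewrite in_itv /= => /andP[av vb]; apply: epsP; apply: le_lt_trans uv.
by apply: mdist_par; apply/andP; split; lra.
Qed.

Definition seg e a b : set Gamma := par e @` `[a, b].

Lemma closed_seg e a b : 0 <= a -> b <= len e -> closed (seg e a b).
Proof.
move=> a0 bl; apply: compact_closed; first exact: metric_hausdorff.
by apply: continuous_compact (par_continuous a0 bl) _; exact: segment_compact.
Qed.

Lemma connected_seg e a b : 0 <= a -> b <= len e -> connected (seg e a b).
Proof.
move=> a0 bl; apply: connected_continuous_connected (par_continuous a0 bl).
exact: segment_connected.
Qed.

Lemma open_par e a b : 0 <= a -> b <= len e -> open (par e @` `]a, b[).
Proof.
move=> a0 bl; rewrite openE => x [u /=]; rewrite in_itv /= => /andP[au ub] <-.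
have ul : 0 <= u <= len e by apply/andP; lra.
apply/nbhs_rayP; split; first by exists u => //=; rewrite in_itv /= au.
move=> [f c] db; have [[w /= wl ew] _] := branchP db.
case: (par_eq wl ul ew) => [[-> _]|[_ [uE|uE]]]; [|by (suff: (1 : R) <= 0 by rewrite ler10); lra..].
apply/near_right0P; exists (Num.min (u - a) (b - u)).
  by rewrite lt_min; apply/andP; lra.
move=> t t0; rewrite lt_min => /andP[t1 t2]; rewrite /ray /= pos_par//.
eexists; last by [].
by rewrite /= in_itv /=; apply/andP; case: (c); lra.
Qed.

(* A connected set cannot accumulate at [p] along a branch without eventually
   containing the branch: it would split between two missed points. *)
Lemma boundary_branch X p : closed X -> connected X -> boundary X p ->
  exists2 d, d \in branches G p & \forall t \near (0 : R)^'+, ~ X (ray p d t).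
Proof.
move=> Xcl Xco [clXp nXp]; have Xp : X p by apply: Xcl.
have [d db nd] : exists2 d, d \in branches G p & ~ \forall t \near (0 : R)^'+, X (ray p d t).
  apply: contrapT => nex; apply: nXp; apply/nbhs_rayP; split=> // d db.
  by apply: contrapT => nd; apply: nex; exists d.
exists d => //; apply: contrapT => nd'.
have [eps sr] := star_radius_ex p; have [eps0 _] := sr.
have freq (P : R -> Prop) r : 0 < r -> ~ (\forall t \near (0 : R)^'+, P t) ->
    exists t, [/\ 0 < t, t < r & ~ P t].
  move=> r0 nP; apply: contrapT => nex; apply: nP; apply/near_right0P.
  exists r => // t t0 tr; apply: contrapT => nPt; apply: nex; by exists t.
have [t1 [t10 t1e nX1]] := freq _ _ eps0 nd.
have [t2 [t20 t21 /contrapT X2]] := freq _ _ t10 nd'.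
have [t3 [t30 t32 nX3]] := freq _ _ t20 nd.
(* [X] meets the open arc between two missed points in a set open and closed in [X], hence lies in
   the arc. Yet [p] lies in [X] and beyond one end of the arc. *)
have cut a b c : 0 <= a -> b <= len d.1 -> a < c < b -> ~ X (par d.1 a) ->
    ~ X (par d.1 b) -> X (par d.1 c) -> (par d.1 @` `]a, b[) p.
  move=> a0 bl /andP[ac cb] Xa Xb Xc.
  suff XE : X `&` par d.1 @` `]a, b[ = X by move: Xp; rewrite -{1}XE => -[].
  apply: Xco.
  - by exists (par d.1 c); split=> //; exists c => //=; rewrite in_itv /= ac.
  - by exists (par d.1 @` `]a, b[) => //; exact: open_par.
  - exists (seg d.1 a b); first exact: closed_seg.
    apply/seteqP; split=> x [Xx [w /=]]; rewrite in_itv /= => /andP[aw wb] ew.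
      by split=> //; exists w => //=; rewrite in_itv /= !ltW.
    split=> //; exists w => //=; rewrite in_itv /= !lt_neqAle aw wb !andbT.
    by apply/andP; split; apply/eqP => wE; [apply: Xa; rewrite wE ew|apply: Xb; rewrite -wE ew].
have [dp hd] := branchP db; have [/andP[p0 pl] ep] := posP dp.
have t1l : 0 <= t1 <= 2 * eps by apply/andP; lra.
have := ray_bound sr db t1l => /andP[]; move: nX1 X2 nX3; rewrite /ray.
case: d.2 {hd} => nX1 X2 nX3 b1 b2.
  have h0 : 0 <= pos d.1 p + t3 by lra.
  have h1 : pos d.1 p + t3 < pos d.1 p + t2 < pos d.1 p + t1 by apply/andP; lra.
  have [w /=] := cut _ _ _ h0 b2 h1 nX3 nX1 X2.
  rewrite in_itv /= => /andP[w1 w2]; rewrite -[in RHS]ep => /par_same.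
  have wl : 0 <= w <= len d.1 by apply/andP; lra.
  have ppl : 0 <= pos d.1 p <= len d.1 by apply/andP.
  move=> /(_ wl ppl) wp; (suff: (1 : R) <= 0 by rewrite ler10); lra.
have h0 : pos d.1 p - t3 <= len d.1 by lra.
have h1 : pos d.1 p - t1 < pos d.1 p - t2 < pos d.1 p - t3 by apply/andP; lra.
have [w /=] := cut _ _ _ b1 h0 h1 nX1 nX3 X2.
rewrite in_itv /= => /andP[w1 w2]; rewrite -[in RHS]ep => /par_same.
have wl : 0 <= w <= len d.1 by apply/andP; lra.
have ppl : 0 <= pos d.1 p <= len d.1 by apply/andP.
move=> /(_ wl ppl) wp; (suff: (1 : R) <= 0 by rewrite ler10); lra.
Qed.

End LocalTopology.

(** * Generic break divisors are universally reduced *)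

Section Components.
Context {R : realType} {Gamma : metricType R}.
Variable G : model Gamma.
Implicit Types (e : edge G) (X : set Gamma).

Lemma component_seg X e (a b u v : R) : 0 <= a -> b <= len e ->
  a <= u <= b -> a <= v <= b -> seg e a b `<=` X ->
  connected_component X (par e u) (par e v).
Proof.
move=> a0 bl ul vl sX; exists (seg e a b); last by exists v => //=; rewrite in_itv.
split=> //; last exact: connected_seg.
by exists u => //=; rewrite in_itv.
Qed.

(** Every point of [X] slides within [X] to an end of its edge. Applied to the complement of the
    chips and to [hull A]. *)
Lemma connected_by_segs X (v0 : vertex G) :
    (forall v : vertex G, X (vtx v) -> connected_component X (vtx v0) (vtx v)) ->
    (forall e u, 0 <= u <= len e -> X (par e u) ->
       seg e 0 u `<=` X \/ seg e u (len e) `<=` X) ->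
  connected X.
Proof.
move=> Xv Xe; suff -> : X = connected_component X (vtx v0) by exact: component_connected.
apply/seteqP; split; last exact: connected_component_sub.
have par_in e u : 0 <= u <= len e -> X (par e u) -> connected_component X (vtx v0) (par e u).
  move=> /andP[u0 ul] Xu; have ul' : 0 <= u <= len e by rewrite u0.
  case: (Xe _ _ ul' Xu) => sX.
    apply: (@connected_component_trans _ _ (vtx (src e))).
      by apply: Xv; rewrite -par_src; apply: sX; exists 0 => //=; rewrite in_itv /= lexx.
    by rewrite -par_src; apply: (component_seg _ _ _ _ sX); rewrite ?lexx ?u0.
  apply: (@connected_component_trans _ _ (vtx (tgt e))).
    by apply: Xv; rewrite -par_tgt; apply: sX; exists (len e) => //=; rewrite in_itv /= lexx ul.
  by rewrite -par_tgt; apply: (component_seg _ _ _ _ sX); rewrite ?lexx ?ul.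
move=> x Xx; case: (model_cover G x) => [[v xv]|[e [s [/andP[s0 sl] xs]]]].
  by rewrite xv in Xx *; exact: Xv.
by rewrite xs in Xx *; apply: par_in; rewrite ?ltW.
Qed.

End Components.

Section Generic.
Context {R : realType} {Gamma : metricType R}.
Variables (G : model Gamma) (T : {set edge G}) (s : edge G -> R).
Hypothesis Tconn : forall u v, connect (adj T) u v.
Hypothesis sint : forall e, e \notin T -> 0 < s e < len e.

Let D : {freeg Gamma} := \sum_(e | e \notin T) << par e (s e) >>.

Let sint' e : e \notin T -> 0 <= s e <= len e.
Proof. by move=> /sint/andP[? ?]; rewrite !ltW. Qed.

Let chips : set Gamma := [set x | exists2 e, e \notin T & x = par e (s e)].

Let coeffD p : coeff p D = \sum_(e | e \notin T) (par e (s e) == p)%:Z.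
Proof. by rewrite /D raddf_sum; apply: eq_bigr => e _; rewrite /= coeffU mul1r natz. Qed.

Let coeff_chip e : e \notin T -> coeff (par e (s e)) D = 1.
Proof.
move=> eT; rewrite coeffD (bigD1 e)//= eqxx big1 ?addr0// => f /andP[fT fe].
case: eqP => // /(par_inj (sint fT) (sint eT))[ef _]; by rewrite ef eqxx in fe.
Qed.

Let coeff_gt0 p : 0 < coeff p D -> chips p.
Proof.
rewrite coeffD => c0; apply: contrapT => np; move: c0; rewrite big1 ?ltxx// => e eT.
by case: eqP => // ep; case: np; exists e.
Qed.

Let nchip_par e u : 0 <= u <= len e -> e \in T \/ u <> s e -> ~ chips (par e u).
Proof.
move=> ul eu [f fT euf].
case: (par_eq ul (sint' fT) euf) => [[ef us]|[_ [sE|sE]]].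
- by subst f; case: eu => [eT|//]; rewrite eT in fT.
- by have := sint fT; rewrite sE ltxx.
- by have := sint fT; rewrite sE ltxx andbF.
Qed.

(** The tree [T] carries no chip and joins all vertices; an edge off [T] is cut at one inner point,
    and each half stays attached to its end. *)
Let nchip_connected : connected (~` chips).
Proof.
have /card_gt0P[v0 _] := vertex_gt0 G.
have nv v : (~` chips) (vtx (v : vertex G)).
  by move=> [e eT /esym]; exact: vtx_notin_par (sint eT).
apply: (@connected_by_segs _ _ G _ v0) => [v _|e u ul].
  have /connectP[q + ->] := Tconn v0 v; elim: q v0 => [|w q IH] v0 /=.
    by move=> _; exact: connected_component_refl.
  case/andP => /existsP[e /andP[eT vw]] /IH; apply: connected_component_trans.
  have l0 := ltW (len_gt0 e).
  have sX : seg e 0 (len e) `<=` ~` chips.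
    by move=> x [t]; rewrite /= in_itv => tl <-; apply: nchip_par => //; left.
  case/orP: vw => /andP[/eqP <- /eqP <-]; rewrite -par_src -par_tgt;
    by apply: (component_seg _ _ _ _ sX); rewrite ?lexx ?l0.
case: (boolP (e \in T)) => eT nu.
  by left=> x [t]; rewrite /= in_itv /= => /andP[t0 tu] <-; apply: nchip_par;
    [rewrite t0 (le_trans tu)//; case/andP: ul|left].
have us : u <> s e by move=> us; apply: nu; exists e; rewrite ?us.
case/andP: ul => u0 ul; have [us'|us'] := ltP u (s e); [left|right] => x [t];
  rewrite /= in_itv /= => /andP[t0 tu] <-; apply: nchip_par; (try by apply/andP; lra);
  right=> ts; [move: tu us'|apply: us]; lra.
Qed.

Let chip_branches e : e \notin T -> let p := par e (s e) in forall b,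
  (e, b) \in branches G p /\ \forall t \near (0 : R)^'+, ~ chips (ray p (e, b) t).
Proof.
move=> eT p b; have /andP[s0 sl] := sint eT; have sl' := sint' eT; split.
  rewrite inE; apply/asboolP; rewrite /p /= pos_par//; split; first exact: on_edge_par.
  by case: b.
apply/near_right0P; exists (Num.min (s e) (len e - s e)).
  by rewrite lt_min s0 subr_gt0.
move=> t t0; rewrite lt_min => /andP[t1 t2]; rewrite /ray /p /= pos_par//.
apply: nchip_par; first by apply/andP; case: b; lra.
by right; case: b; lra.
Qed.

Lemma generic_q_reduced q : q_reduced q D.
Proof.
split=> [p _|X [x0 Xx0] Xcl Xco nXq].
  by rewrite coeffD sumr_ge0.
apply: contrapT => nex.
have Xle p : boundary X p -> (outdeg X p)%:Z <= coeff p D.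
  by move=> Xp; rewrite leNgt; apply/negP => lt; apply: nex; exists p.
(* Some branch leaves [X] at a boundary point, so [Xle] puts a chip there. *)
have bchip p : boundary X p -> chips p.
  move=> Xp; apply: coeff_gt0; apply: lt_le_trans (Xle _ Xp).
  have [d db dX] := boundary_branch G Xcl Xco Xp.
  rewrite (outdegE G) ltz_nat; apply/card_gt0P; exists d.
  by rewrite inE db; exact/asboolP.
have [[x [Xx nx]]|nU] := pselect (exists x, X x /\ ~ chips x).
  (* Off the chips [X] has no boundary, so it is open and closed in a connected set. *)
  have UX : ~` chips `&` X = ~` chips.
    apply: nchip_connected; first by exists x.
      exists X°; first exact: open_interior.
      apply/seteqP; split=> y [ny Xy]; split=> //; last exact: interior_subset.
      apply: contrapT => nXy; apply: ny; apply: bchip; split=> //.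
      exact: subset_closure.
    by exists X.
  (* If [q] is a chip, its branches are free of chips near [q], hence in [X], while the complement
     of the closed set [X] would be a neighbourhood of [q]. *)
  apply: nXq; have [[e eT qe]|] := pselect (chips q); last first.
    by move=> nq; have [] : (~` chips `&` X) q by rewrite UX.
  apply: contrapT => nXq; have : nbhs q (~` X).
    by apply: open_nbhs_nbhs; split=> //; exact: closed_openC.
  move=> /(nbhs_rayP G)[_]; have := chip_branches eT true; rewrite -qe => -[db nc] /(_ _ db).
  move=> nX; have [t [nt]] := @filter_ex _ _ (at_right_proper_filter (0 : R)) _ (filterI nc nX); apply.
  by have [] : (~` chips `&` X) (ray q (e, true) t) by rewrite UX.
have /contrapT[e eT xe] : ~ ~ chips x0 by move=> nx0; apply: nU; exists x0.
have Xchip y : X y -> chips y by move=> Xy; apply: contrapT => ny; apply: nU; exists y.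
(* Here [X] consists of chips: near [x0] both directions leave it, and [x0] carries only one
   chip. *)
have bx0 : boundary X x0.
  split; first exact: subset_closure.
  move=> /(nbhs_rayP G)[_]; have := chip_branches eT true; rewrite -xe => -[db nc] /(_ _ db).
  by move=> Xr; have [t [nt /Xchip]] := @filter_ex _ _ (at_right_proper_filter (0 : R)) _ (filterI nc Xr).
have := Xle _ bx0; rewrite {2}xe coeff_chip// leNgt => /negP; apply.
rewrite (outdegE G) ltz_nat; have cc : #|[set (e, true); (e, false)]%SET| = 2%N by rewrite cards2 xpair_eqE eqxx.
rewrite -[ltnLHS]/1%N -[X in (X <= _)%N]cc; apply: subset_leq_card.
apply/fintype.subsetP => d; rewrite !inE => dE.
have [b ->] : exists b, d = (e, b) by case/orP: dE => /eqP ->; eexists.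
have := chip_branches eT b; rewrite -xe => -[]; rewrite inE => -> nc /=.
by apply/asboolP; apply: filterS nc => t nt /Xchip.
Qed.

End Generic.

(** * Universally reduced divisors are break divisors of every model *)

Lemma int_between_0_2 (c : int) (n : nat) : 0 < c -> c < n%:Z -> (n <= 2)%N -> c = 1.
Proof. lia. Qed.

Lemma int_between_0_1 (c : int) (n : nat) : 0 < c -> c < n%:Z -> ~ (n <= 1)%N.
Proof. lia. Qed.

Section ReducedToBreak.
Context {R : realType} {Gamma : metricType R}.
Variables (G : model Gamma) (D : {freeg Gamma}).
Hypothesis D_ge0 : forall x, 0 <= coeff x D.
Hypothesis D_red : forall q, q_reduced q D.
Implicit Types (e : edge G) (u s : R) (A : {set vertex G}).

Lemma outdeg_le X p (B : {set dart G}) :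
    (forall d, d \in branches G p -> d \notin B ->
       \forall t \near (0 : R)^'+, X (ray p d t)) ->
  (outdeg X p <= #|B|)%N.
Proof.
move=> XB; rewrite (outdegE G); apply: subset_leq_card.
apply/fintype.subsetP => d; rewrite inE => /andP[db /asboolP dX].
apply: contraT => dB; have [t [+]] := @filter_ex _ _ (at_right_proper_filter (0 : R)) _ (filterI dX (XB _ db dB)).
by [].
Qed.

Lemma branch_interior e u d : 0 < u < len e -> d \in branches G (par e u) -> d.1 = e.
Proof.
move=> /andP[u0 ul] /branchP[[w wl ew] _].
have ul' : 0 <= u <= len e by rewrite !ltW.
by case: (par_eq wl ul' ew) => [[]//|[_ [uE|uE]]]; move: u0 ul; rewrite uE ltxx.
Qed.

Lemma ray_right e u : 0 <= u <= len e -> forall t, ray (par e u) (e, true) t = par e (u + t).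
Proof. by move=> ul t; rewrite /ray /= pos_par. Qed.

Lemma ray_left e u : 0 <= u <= len e -> forall t, ray (par e u) (e, false) t = par e (u - t).
Proof. by move=> ul t; rewrite /ray /= pos_par. Qed.

Lemma vtx_nseg e a b (v : vertex G) : 0 < a -> b < len e -> ~ seg e a b (vtx v).
Proof.
move=> a0 bl [u]; rewrite /= in_itv /= => /andP[au ub] /vtx_notin_par; apply.
by apply/andP; lra.
Qed.

Lemma seg_interior e a b u : 0 <= a -> b <= len e -> a < u < b -> (seg e a b)° (par e u).
Proof.
move=> a0 bl uab; have : open (par e @` `]a, b[) by exact: open_par.
rewrite openE => op; have : (par e @` `]a, b[)° (par e u).
  by apply: op; exists u => //=; rewrite in_itv.
apply: filterS => x [w]; rewrite /= in_itv /= => /andP[aw wb] <-.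
by exists w => //=; rewrite in_itv /= !ltW.
Qed.

(** The segment from [s] to [s'] avoids the vertices, so reducedness at a vertex applies to it. If
    [s < s'], each of its two boundary points has a chip and a single leaving direction, a
    contradiction. If [s = s'], at most two directions leave, which bounds the multiplicity by
    one. *)
Lemma one_chip e s s' : 0 < s -> s <= s' -> s' < len e ->
  0 < coeff (par e s) D -> 0 < coeff (par e s') D ->
  s = s' /\ coeff (par e s) D = 1.
Proof.
move=> s0 ss' sl c c'; have [sl' sl1'] : 0 <= s <= len e /\ 0 <= s' <= len e by split; apply/andP; lra.
have := (D_red (vtx (src e))).2 (seg e s s').
case.
- by exists (par e s), s => //=; rewrite in_itv /= lexx.
- by apply: closed_seg; rewrite ltW.
- by apply: connected_seg; rewrite ltW.
- exact: vtx_nseg.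
move=> p [clp nip]; have {clp} : seg e s s' p.
  by apply: (closed_seg (ltW s0) (ltW sl)).
case=> u; rewrite /= in_itv /= => /andP[su us'] up; subst p.
have ui : 0 < u < len e by apply/andP; lra.
have bE d : d \in branches G (par e u) -> d = (e, d.2).
  by move=> /(branch_interior ui) <-; case: d.
have ul' : 0 <= u <= len e by apply/andP; lra.
move=> lt; have [E|ne] := eqVneq s s'.
  split=> //; have uE : u = s by apply/eqP; rewrite eq_le su E us'.
  have o2 : (outdeg (seg e s s') (par e u) <= 2)%N.
    rewrite (_ : 2%N = #|[set (e, true); (e, false)]%SET|); last by rewrite cards2 xpair_eqE eqxx.
    by apply: outdeg_le => d /bE -> ; rewrite !inE !xpair_eqE eqxx; case: d.2.
  by move: lt o2; rewrite uE; exact: int_between_0_2.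
have {ne}ss : s < s' by rewrite lt_neqAle ne.
suff : (outdeg (seg e s s') (par e u) <= 1)%N.
  have [uE|us] := eqVneq u s; first by move: lt; rewrite uE => l /(int_between_0_1 _ l); case.
  have [uE|us2] := eqVneq u s'; first by move: lt; rewrite uE => l /(int_between_0_1 _ l); case.
  case: nip; apply: seg_interior; [exact: ltW..|].
  by rewrite !lt_neqAle su us' us2 eq_sym us.
have [uE|us] := eqVneq u s.
  rewrite (_ : 1%N = #|[set (e, false)]%SET|); last by rewrite cards1.
  apply: outdeg_le => d /bE ->; rewrite !inE xpair_eqE eqxx; case: d.2 => // _.
  apply/near_right0P; exists (s' - s); rewrite ?subr_gt0// => t t0 tl; rewrite ray_right//.
  by exists (u + t) => //=; rewrite in_itv /=; apply/andP; lra.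
rewrite (_ : 1%N = #|[set (e, true)]%SET|); last by rewrite cards1.
apply: outdeg_le => d /bE ->; rewrite !inE xpair_eqE eqxx; case: d.2 => // _.
have su1 : s < u by rewrite lt_neqAle eq_sym us.
apply/near_right0P; exists (u - s); rewrite ?subr_gt0// => t t0 tl; rewrite ray_left//.
by exists (u - t) => //=; rewrite in_itv /=; apply/andP; lra.
Qed.

Definition chip_set e : set R := [set s | 0 < s < len e /\ 0 < coeff (par e s) D].
Definition chip e : R := xget 0 (chip_set e).
Definition chip_edges : {set edge G} := [set e | `[< chip_set e !=set0 >]]%SET.

Lemma chipP e : e \in chip_edges ->
  0 < chip e < len e /\ coeff (par e (chip e)) D = 1.
Proof.
rewrite inE => /asboolP => -[s es]; have [ci c0] : chip_set e (chip e) by apply: xgetPex; exists s.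
have /andP[c1 c2] := ci.
by have [_ ->] := one_chip c1 (lexx _) c2 c0 c0.
Qed.

Lemma coeff_interior e s : 0 < s < len e ->
  coeff (par e s) D = ((e \in chip_edges) && (s == chip e))%:Z.
Proof.
move=> /andP[s0 sl]; have := D_ge0 (par e s); rewrite le_eqVlt => /predU1P[c0|c0].
  case: (boolP (e \in chip_edges)) => //= eF; case: eqP => // sE.
  by move: c0; rewrite sE (chipP eF).2.
have eF : e \in chip_edges.
  by rewrite inE; apply/asboolP; exists s; split=> //; rewrite s0.
have [/andP[c1 c2] cE] := chipP eF; have c01 : 0 < coeff (par e (chip e)) D by rewrite cE.
have sE : s = chip e.
  have [sc|cs] := leP s (chip e); first by have [] := one_chip s0 sc c2 c0 c01.
  by have [] := one_chip c1 (ltW cs) sl c01 c0.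
by rewrite eF sE eqxx cE.
Qed.

Lemma divisor_decomposition :
  D = \sum_(v : vertex G) << coeff (vtx v) D *g vtx v >>
    + \sum_(e in chip_edges) << par e (chip e) >>.
Proof.
apply/eqP/freeg_eqP => x; rewrite raddfD /= !raddf_sum /=.
under eq_bigr do rewrite coeffU.
under [X in _ + X]eq_bigr do rewrite coeffU mul1r.
case: (model_cover G x) => [[v ->]|[e [s [si ->]]]].
  rewrite (bigD1 v)//= eqxx mulr1 big1 => [|w wv]; last first.
    by rewrite (inj_eq (@vtx_inj _ _ G)) (negbTE wv) mulr0.
  rewrite big1 ?addr0// => e /chipP[ci _].
  by case: eqP => // /(vtx_notin_par ci).
rewrite big1 ?add0r => [|v _]; last first.
  by case: eqP => [ve|]; rewrite ?mulr0//; case: (vtx_notin_par (v := v) si).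
rewrite coeff_interior//; have [eF|eF] := boolP (e \in chip_edges); last first.
  rewrite big1// => f fF; case: eqP => // fe.
  by have [fE _] := par_inj (chipP fF).1 si fe; rewrite -fE fF in eF.
rewrite (bigD1 e)//= big1 => [|f /andP[fF fe]]; last first.
  by case: eqP => // /(par_inj (chipP fF).1 si)[fE _]; rewrite fE eqxx in fe.
rewrite addr0 natz; congr (Posz (nat_of_bool _)); apply/eqP/eqP => [->//|].
by move=> /(par_inj (chipP eF).1 si)[].
Qed.

Definition lo A e : R :=
  if src e \in A then 0 else if e \in chip_edges then chip e else len e.
Definition hi A e : R :=
  if tgt e \in A then len e else if e \in chip_edges then chip e else 0.

(* An edge leaving [A] is kept up to its chip; without a chip, [lo] and [hi]
   leave only its endpoint in [A]. *)
Definition hull A : set Gamma :=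
  [set x | exists2 v, v \in A & x = vtx v] `|`
  [set x | exists2 e, (src e \in A) || (tgt e \in A) & seg e (lo A e) (hi A e) x].

Lemma lo_bound A e : 0 <= lo A e <= len e.
Proof.
rewrite /lo; have l0 := ltW (len_gt0 e); case: ifP => _; first by rewrite lexx l0.
by case: ifP => [/chipP[/andP[c1 c2] _]|_]; rewrite ?l0 ?lexx ?ltW.
Qed.

Lemma hi_bound A e : 0 <= hi A e <= len e.
Proof.
rewrite /hi; have l0 := ltW (len_gt0 e); case: ifP => _; first by rewrite lexx l0.
by case: ifP => [/chipP[/andP[c1 c2] _]|_]; rewrite ?l0 ?lexx ?ltW.
Qed.

Lemma hull_par A e u : (src e \in A) || (tgt e \in A) ->
  lo A e <= u <= hi A e -> hull A (par e u).
Proof. by move=> eA ul; right; exists e => //; exists u => //=; rewrite in_itv. Qed.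

(** A kept segment stops strictly before an end outside [A], so such a vertex can be the base point
    when the hull is fired. *)
Lemma hull_vtx A (v : vertex G) : hull A (vtx v) <-> v \in A.
Proof.
split=> [[[w wA /vtx_inj ->//]|[e eA [u]]]|vA]; last by left; exists v.
have /andP[l0 l1] := lo_bound A e; have /andP[h0 h1] := hi_bound A e.
rewrite /= in_itv /= => /andP[lu uh] uv.
have ul : 0 <= u <= len e by rewrite (le_trans l0 lu) (le_trans uh h1).
have [|uE|uE] := (par_end_vtx ul).2; first by exists v.
  move: uv lu; rewrite uE par_src => /vtx_inj <-; rewrite /lo; case: ifP => // _.
  case: ifP => [/chipP[/andP[c1 _] _]|_]; first by rewrite leNgt c1.
  by rewrite leNgt len_gt0.
move: uv uh; rewrite uE par_tgt => /vtx_inj <-; rewrite /hi; case: ifP => // _.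
case: ifP => [/chipP[/andP[_ c1] _]|_]; first by rewrite leNgt c1.
by rewrite leNgt len_gt0.
Qed.

Lemma closed_hull A : closed (hull A).
Proof.
apply: closedU.
  rewrite (_ : [set x | _] = \bigcup_(v in [set` A]) [set vtx v]).
    apply: closed_bigcup => // v _; apply: compact_closed; first exact: metric_hausdorff.
    exact: compact_set1.
  by apply/seteqP; split=> x [v vA xv]; exists v.
rewrite (_ : [set x | _] =
  \bigcup_(e in [set e | (src e \in A) || (tgt e \in A)]) seg e (lo A e) (hi A e)).
  apply: closed_bigcup => [|e _].
    exact: (finite_finpred [pred e : edge G | (src e \in A) || (tgt e \in A)]).
  apply: closed_seg.
    by case/andP: (lo_bound A e).
  by case/andP: (hi_bound A e).
by apply/seteqP; split=> x [e eA xe]; exists e.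
Qed.

(** Edges with both ends in [A] are kept whole and carry paths of [A]; a point of a partly kept edge
    slides to the end in [A]. *)
Lemma connected_hull A v0 : v0 \in A ->
    (forall v, v \in A ->
       connect [rel x y | [&& x \in A, y \in A & adj [set: edge G]%SET x y]] v0 v) ->
  connected (hull A).
Proof.
move=> v0A Aconn; apply: (@connected_by_segs _ _ G _ v0) => [v /hull_vtx/Aconn|e u ul].
  move=> /connectP[q + ->]; elim: q v0 v0A {Aconn} => [|w q IH] x xA /=.
    by move=> _; apply: connected_component_refl; exact/hull_vtx.
  case/andP => /and3P[_ wA /existsP[e /andP[_ xw]]] /(IH _ wA).
  apply: connected_component_trans; have l0 := ltW (len_gt0 e).
  have [sA tA] : src e \in A /\ tgt e \in A.
    by case/orP: xw => /andP[/eqP <- /eqP <-] in xA wA *.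
  have sX : seg e 0 (len e) `<=` hull A.
    move=> y [t /=]; rewrite in_itv => tl <-.
    by apply: hull_par; rewrite ?sA// /lo /hi sA tA.
  case/orP: xw => /andP[/eqP <- /eqP <-]; rewrite -par_src -par_tgt;
    by apply: (component_seg _ _ _ _ sX); rewrite ?lexx ?l0.
have atend f w : hull A (par f w) -> seg f w w `<=` hull A.
  by move=> h x [t /=]; rewrite in_itv /= -eq_le => /eqP <- <-.
have atvtx (v : vertex G) : par e u = vtx v -> hull A (par e u) ->
    seg e 0 u `<=` hull A \/ seg e u (len e) `<=` hull A.
  move=> uv hu; have [|uE|uE] := (par_end_vtx ul).2; first by exists v.
    by left; rewrite (_ : seg e 0 u = seg e u u); [exact: atend|rewrite uE].
  by right; rewrite (_ : seg e u (len e) = seg e u u); [exact: atend|rewrite uE].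
have := ul => /andP[u0 u1] hu; have := hu; case=> [[v vA /atvtx]|[f fA [w /=]]]; first exact.
have /andP[l0 l1] := lo_bound A f; have /andP[h0 h1] := hi_bound A f.
rewrite in_itv /= => /andP[lw wh] fw.
have wl : 0 <= w <= len f by rewrite (le_trans l0 lw) (le_trans wh h1).
case: (par_eq wl ul fw) => [[fe wu]|[_ ue]]; last first.
  by have [v uv] := (par_end_vtx ul).1 ue; exact: atvtx uv hu.
subst f w; case/orP: (fA) => inA; [left|right] => x [t /=]; rewrite in_itv /= => /andP[t0 t1] <-.
  by apply: hull_par => //; rewrite {1}/lo inA t0 (le_trans t1).
by apply: hull_par => //; rewrite [hi A e]/hi inA t1 (le_trans lw).
Qed.

(** Reducedness at a vertex outside [A] gives a boundary point of the hull with too few chips.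
    Inside an edge the boundary points are cuts at a chip, with one chip and at most one leaving
    direction; so the point is a vertex of [A], where only chipless edges out of [A] leave the
    hull. *)
Lemma dhar_connected A v0 : v0 \in A -> A != [set: vertex G]%SET ->
    (forall v, v \in A ->
       connect [rel x y | [&& x \in A, y \in A & adj [set: edge G]%SET x y]] v0 v) ->
  exists2 v, v \in A & coeff (vtx v) D <
    #|exits (@src _ G) (@tgt _ G) (~: chip_edges) A v|%:Z.
Proof.
move=> v0A AT Aconn.
have [w wA] : exists w, w \notin A.
  apply/existsP; apply: contraR AT => /existsPn h; apply/eqP/setP => x.
  by rewrite inE; apply/negPn/h.
have [||||p [clp nip] lt] := (D_red (vtx w)).2 (hull A).
- by exists (vtx v0); apply/hull_vtx.
- exact: closed_hull.
- exact: connected_hull v0A Aconn.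
- by move=> /hull_vtx; exact/negP.
have {clp} hp : hull A p by exact: closed_hull.
have [[v pv]|[e [u [ui pu]]]] := model_cover G p; subst p.
  move/hull_vtx : hp => vA; exists v => //; apply: lt_le_trans lt _; rewrite lez_nat.
  set Ex := exits _ _ _ _ _.
  (* The flag [src e == v] turns an edge at [v] into the dart pointing away from [v]. *)
  apply: leq_trans (leq_imset_card (fun e => (e, src e == v) : dart G) Ex).
  apply: outdeg_le => -[e b] db dB; have [[u /= ul uv] _] := branchP db.
  have [/= _ hb] := branchP db; move: hb; rewrite -uv pos_par// => hb.
  have ue : u = 0 \/ u = len e by apply/(par_end_vtx ul); exists v.
  have l0 := len_gt0 e; case: b db dB hb => db dB hb.
    have uE : u = 0 by case: ue => // uE; move: hb; rewrite uE ltxx.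
    have vE : src e = v by apply: (@vtx_inj _ _ G); rewrite -par_src -uE.
    have tC : tgt e \in A \/ e \in chip_edges.
      apply/orP; apply: contraR dB; rewrite negb_or => /andP[tA eF].
      by apply/imsetP; exists e; rewrite ?vE ?eqxx// inE finset.in_setC eF vE eqxx tA.
    have h0 : 0 < hi A e.
      by rewrite /hi; case: ifP => // tA; case: tC => [|eF]; rewrite ?tA// eF; case/andP: (chipP eF).1.
    apply/near_right0P; exists (hi A e) => // t t0 th; rewrite ray_right//.
    by apply: hull_par; rewrite ?vE ?vA// /lo vE vA uE add0r !ltW.
  have uE : u = len e by case: ue => // uE; move: hb; rewrite uE ltxx.
  have vE : tgt e = v by apply: (@vtx_inj _ _ G); rewrite -par_tgt -uE.
  have tC : src e \in A \/ e \in chip_edges.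
    apply/orP; apply: contraR dB; rewrite negb_or => /andP[tA eF].
    have sv : (src e == v) = false by rewrite -vE (negbTE (src_neq_tgt e)).
    by apply/imsetP; exists e; rewrite ?sv// inE finset.in_setC eF vE eqxx tA orbT.
  have h0 : lo A e < len e.
    by rewrite /lo; case: ifP => // tA; case: tC => [|eF]; rewrite ?tA// eF; case/andP: (chipP eF).1.
  apply/near_right0P; exists (len e - lo A e); rewrite ?subr_gt0// => t t0 th; rewrite ray_left//.
  apply: hull_par; rewrite ?vE ?vA ?orbT// /hi vE vA uE; apply/andP; lra.
exfalso; have /andP[u0 ul] := ui; have ul' : 0 <= u <= len e by rewrite !ltW.
have [eA lu uh] : [/\ (src e \in A) || (tgt e \in A), lo A e <= u & u <= hi A e].
  case: hp => [[v _ /(vtx_notin_par ui)//]|[f fA [x /=]]].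
  have /andP[l0 l1] := lo_bound A f; have /andP[h0 h1] := hi_bound A f.
  rewrite in_itv /= => /andP[lx xh] fx.
  have xl : 0 <= x <= len f by rewrite (le_trans l0 lx) (le_trans xh h1).
  case: (par_eq xl ul' fx) => [[fe xu]|[_ [uE|uE]]]; first by subst f x.
    by rewrite uE ltxx in u0.
  by rewrite uE ltxx in ul.
have bE d : d \in branches G (par e u) -> d = (e, d.2).
  by move=> /(branch_interior ui) <-; case: d.
have /andP[l0 _] := lo_bound A e; have /andP[_ h1] := hi_bound A e.
(* At either end of the kept segment [u] is the chip, and the direction back into the segment does
   not leave; strictly between the ends, [u] is interior to the hull. *)
have [lE|lne] := eqVneq (lo A e) u.
  have sA : src e \notin A.
    by apply/negP => sA; move: lE u0; rewrite /lo sA => <-; rewrite ltxx.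
  have tA : tgt e \in A by move: eA; rewrite (negbTE sA).
  move: lE; rewrite /lo (negbTE sA); case: ifP => [eF cE|_ lE]; last by move: ul; rewrite -lE ltxx.
  have c1 := (chipP eF).2; rewrite cE in c1; move: lt; rewrite c1.
  apply/negP; rewrite -leNgt lez_nat (_ : 1%N = #|[set (e, false)]%SET|); last by rewrite cards1.
  apply: outdeg_le => d /bE ->; rewrite !inE xpair_eqE eqxx; case: d.2 => // _.
  apply/near_right0P; exists (len e - u); rewrite ?subr_gt0// => t t0 tl; rewrite ray_right//.
  by apply: hull_par => //; rewrite [hi A e]/hi tA; apply/andP; lra.
have [hE|hne] := eqVneq u (hi A e).
  have tA : tgt e \notin A.
    by apply/negP => tA; move: ul; rewrite hE /hi tA ltxx.
  have sA : src e \in A by move: eA; rewrite (negbTE tA) orbF.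
  move: hE; rewrite /hi (negbTE tA); case: ifP => [eF cE|_ uE]; last by move: u0; rewrite uE ltxx.
  have c1 := (chipP eF).2; rewrite -cE in c1; move: lt; rewrite c1.
  apply/negP; rewrite -leNgt lez_nat (_ : 1%N = #|[set (e, true)]%SET|); last by rewrite cards1.
  apply: outdeg_le => d /bE ->; rewrite !inE xpair_eqE eqxx; case: d.2 => // _.
  apply/near_right0P; exists u => // t t0 tl; rewrite ray_left//.
  by apply: hull_par => //; rewrite [lo A e]/lo sA; apply/andP; lra.
apply: nip; have /(seg_interior l0 h1) : lo A e < u < hi A e.
  by rewrite !lt_neqAle lne hne lu.
by apply: filterS => x xs; right; exists e.
Qed.

(** Passes to a connected component [A'] of [A]: an edge from [A'] to a vertex outside [A'] leaves
    [A] as well. *)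
Lemma dhar_reduced A : A != finset.set0 -> A != [set: vertex G]%SET ->
  exists2 v, v \in A & coeff (vtx v) D <
    #|exits (@src _ G) (@tgt _ G) (~: chip_edges) A v|%:Z.
Proof.
move=> /set0Pn[v0 v0A] AT.
pose r (B : {set vertex G}) := [rel x y | [&& x \in B, y \in B & adj [set: edge G]%SET x y]].
have stayA x q : x \in A -> path (r A) x q -> last x q \in A.
  by elim: q x => //= w q IH x xA /andP[/and3P[_ wA _]]; exact: IH.
pose A' : {set vertex G} := [set v | connect (r A) v0 v]%SET.
have A'A : A' \subset A.
  apply/fintype.subsetP => v; rewrite inE => /connectP[q + ->].
  exact: stayA.
have v0A' : v0 \in A' by rewrite inE.
have stepA' x y : x \in A' -> r A x y -> y \in A'.
  rewrite [x \in _]inE [y \in _]inE => vx xy.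
  by apply: (connect_trans vx); exact: connect1.
have pathA' x q : x \in A' -> path (r A) x q -> path (r A') x q.
  elim: q x => //= y q IH x xA' /andP[xy yq]; have yA' := stepA' _ _ xA' xy.
  by rewrite IH// andbT xA' yA'; case/and3P: xy.
have [||v vA' vlt] := @dhar_connected A' v0 v0A'.
- by apply: contraNneq AT => A'T; rewrite -finset.subTset -A'T.
- move=> v; rewrite inE => /connectP[q qp ->]; apply/connectP; exists q => //.
  exact: pathA'.
have vA : v \in A by exact: (fintype.subsetP A'A).
exists v => //; apply: lt_le_trans vlt _; rewrite lez_nat; apply: subset_leq_card.
apply/fintype.subsetP => e; rewrite [e \in exits _ _ _ A' v]inE [e \in exits _ _ _ A v]inE => /andP[-> /=].
have out w : adj [set: edge G]%SET v w -> w \notin A' -> w \notin A.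
  by move=> vw; apply: contraNN => wA; apply: (stepA' v) => //=; rewrite vA wA.
case/orP => /andP[/eqP ev] /out nA; apply/orP; [left|right]; rewrite ev eqxx nA//.
  by apply/existsP; exists e; rewrite inE ev !eqxx.
by apply/existsP; exists e; rewrite inE ev !eqxx orbT.
Qed.

Lemma reduced_break : deg D = (genus G)%:Z ->
  exists (T : {set edge G}) (p : edge G -> Gamma),
    [/\ spanning_tree T, forall e, e \notin T -> closed_edge e (p e)
      & D = \sum_(e | e \notin T) << p e >>].
Proof.
move=> degD; pose d (v : vertex G) : nat := `|coeff (vtx v) D|%N.
have dE v : (d v)%:Z = coeff (vtx v) D by rewrite /d gez0_abs.
have dhar A : A != finset.set0 -> A != [set: vertex G]%SET ->
    exists2 v, v \in A & (d v < #|exits (@src _ G) (@tgt _ G) (~: chip_edges) A v|)%N.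
  by move=> A0 AT; have [v vA vd] := dhar_reduced A0 AT; exists v; rewrite // -ltz_nat dE.
have K1 : (#|(~: chip_edges)%SET|.+1 = \sum_v d v + #|vertex G|)%N.
  have gE : ((\sum_v d v)%N + #|chip_edges|)%N = genus G.
    apply/eqP; rewrite -eqz_nat -degD (congr1 (@deg _) divisor_decomposition).
    rewrite PoszD (big_morph Posz PoszD erefl) raddfD /= !raddf_sum /=.
    apply/eqP; congr (_ + _); first by apply: eq_bigr => v _; rewrite degU dE.
    by under eq_bigr do rewrite degU; rewrite sumr_const natz.
  (* [genus] is a truncated subtraction; Dhar's inequality for the complement of a vertex shows that
     nothing is truncated. *)
  have VE : (#|vertex G| <= #|edge G|.+1)%N.
    have /card_gt0P[q _] := vertex_gt0 G.
    have := @dhar_touching _ _ _ _ _ d dhar [set~ q]%SET.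
    have -> : ([set~ q] != [set: vertex G])%SET.
      by apply/eqP => /setP/(_ q); rewrite !inE eqxx.
    move=> /(_ isT) le1; rewrite -(cardsC [set q]%SET) cards1 ltnS.
    apply: leq_trans (max_card (~: chip_edges)%SET).
    apply: leq_trans (leq_trans le1 _).
      by rewrite -sum1_card; apply: leq_sum => v _.
    by rewrite /touching -sum1_card; apply: leq_sum => e _; case: (_ || _).
  have := cardsC chip_edges; move: gE; rewrite /genus.
  move: (#|chip_edges|) (#|(~: chip_edges)%SET|) (\sum_v d v)%N VE => a b c; lia.
have [T [h [Tst TK hst hd]]] := break_of_dhar K1 dhar.
(* An edge with an inner chip lies off [T] and takes that chip; any other edge off [T] takes a chip
   at its head. *)
exists T, (fun e => if e \in chip_edges then par e (chip e) else vtx (h e)).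
split=> // [e _|].
  case: ifP => [/chipP[/andP[c1 c2] _]|_]; first by exists (chip e) => //=; rewrite !ltW.
  have l0 := ltW (len_gt0 e); case: (hst e) => ->.
    by exists 0; rewrite /= ?par_src// lexx l0.
  by exists (len e); rewrite /= ?par_tgt// lexx l0.
apply: etrans divisor_decomposition _; rewrite [RHS](bigID (fun e => e \in chip_edges))/= [RHS]addrC.
have FT e : e \in chip_edges -> e \notin T.
  by move=> eF; apply/negP => /(fintype.subsetP TK); rewrite finset.in_setC eF.
congr (_ + _); last first.
  rewrite (eq_bigl (fun e => (e \notin T) && (e \in chip_edges))); last first.
    by move=> e; case: (boolP (e \in chip_edges)) => [/FT ->|]; rewrite ?andbF.
  by apply: eq_bigr => e /andP[_ ->].
rewrite (partition_big h xpredT)//=; apply: eq_bigr => v _.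
transitivity (\sum_(e | (e \notin T) && (e \notin chip_edges) && (h e == v)) << vtx (v : vertex G) >> : {freeg Gamma}); last first.
  by apply: eq_bigr => e /andP[/andP[_ /negbTE ->] /eqP ->].
rewrite sumr_const -dE -hd; apply/eqP/freeg_eqP => x; rewrite raddfMn /= !coeffU mul1r.
rewrite -[RHS]mulr_natl !natz; congr (Posz _ * _); apply: eq_card => e.
by rewrite finset.in_set finset.in_setD finset.in_setC [RHS]unfold_in.
Qed.

End ReducedToBreak.

(** * Closure in the symmetric product *)

Section SymmetricProduct.
Context {R : realType} {Gamma : metricType R} {g : nat}.

Lemma ptws_cvg (Fi : set_system R) (phi : R -> {ptws 'I_g -> Gamma})
    (p : {ptws 'I_g -> Gamma}) : Filter Fi ->
  (forall i, phi t i @[t --> Fi] --> p i) -> phi @ Fi --> p.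
Proof.
move=> FF phip; apply/cvg_sup => i.
move=> A /=; rewrite (@nbhsE (initial_topology (fun f : 'I_g -> Gamma => f i))).
move=> [B [[C oC CB] Bp] BA]; apply: filterS BA _; rewrite -CB /=.
rewrite -CB in Bp; apply: (phip i); exact: open_nbhs_nbhs.
Qed.

(** Links sums over the edges off a tree to ['I_g], the index type of the product that defines
    [Divplus]. *)
Definition enumerates (E : finType) (B : {set E}) (f : 'I_g -> E) : Prop :=
  injective f /\ forall e, e \in B <-> exists i, f i = e.

Lemma enumerates_sum (E : finType) (B : {set E}) (f : 'I_g -> E) (V : nmodType) (F : E -> V) :
  enumerates B f -> \sum_(e in B) F e = \sum_i F (f i).
Proof.
move=> [finj fB]; rewrite (_ : B = [set f i | i in 'I_g]%SET).
  by rewrite big_imset //= => i j _ _; exact: finj.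
apply/setP => e; apply/idP/imsetP => [/fB[i <-]|[i _ ->]]; first by exists i.
by apply/fB; exists i.
Qed.

Lemma divisor_enumerates (E : finType) (B : {set E}) (p : E -> Gamma)
    (D : Divplus Gamma g) : divisor D = \sum_(e in B) << p e >> ->
  exists f : 'I_g -> E, enumerates B f.
Proof.
move=> DE; have cB : g = #|B|.
  have /andP[_ /eqP] : effective (divisor D) && (deg (divisor D) == g%:Z).
    exact: (svalP (D : effdiv _ _)).
  rewrite DE raddf_sum /=; under eq_bigr do rewrite degU.
  by rewrite sumr_const natz => -[].
exists (fun i => enum_val (cast_ord cB i)); split=> [i j /enum_val_inj/cast_ord_inj//|e].
split=> [eB|[i <-]]; last exact: enum_valP.
by exists (cast_ord (esym cB) (enum_rank_in eB e)); rewrite cast_ordKV enum_rankK_in.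
Qed.

Lemma divisor_sum_points (E : finType) (B : {set E}) (f : 'I_g -> E) (p : E -> Gamma) :
  enumerates B f ->
  divisor (sum_points (fun i => p (f i)) : Divplus Gamma g) = \sum_(e in B) << p e >>.
Proof. by move=> /enumerates_sum ->. Qed.

Lemma sum_notin (E : finType) (V : nmodType) (T : {set E}) (F : E -> V) :
  \sum_(e | e \notin T) F e = \sum_(e in ~: T) F e.
Proof. by apply: eq_bigl => e; rewrite finset.in_setC. Qed.

(** The model is fixed here, whereas [break_divisor] lets it vary; a fixed model has finitely many
    trees. *)
Definition break_of (G : model Gamma) (D : {freeg Gamma}) : Prop :=
  exists (T : {set edge G}) (p : edge G -> Gamma),
    [/\ spanning_tree T, forall e, e \notin T -> closed_edge e (p e)
      & D = \sum_(e | e \notin T) << p e >>].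

Lemma closed_closed_edge (G : model Gamma) (e : edge G) : closed (closed_edge e).
Proof.
rewrite (_ : closed_edge e = seg e 0 (len e)); first exact: closed_seg.
by apply/seteqP; split=> x [u /= ul <-]; exists u => //=; move: ul; rewrite in_itv.
Qed.

(** The quotient topology tests closedness on the preimage in the product: a finite union, over
    spanning trees and enumerations of their complements, of products of closed edges. *)
Lemma closed_break_of (G : model Gamma) :
  closed [set D : Divplus Gamma g | break_of G (divisor D)].
Proof.
rewrite -openC open_DivplusE.
rewrite (_ : [set p | _] = ~` [set p | break_of G (divisor (sum_points p : Divplus Gamma g))])//.
rewrite openC.
pose Q :=
  [set tf : {set edge G} * {ffun 'I_g -> edge G} | spanning_tree tf.1 /\ enumerates (~: tf.1)%SET tf.2].
rewrite (_ : [set p | _] = \bigcup_(tf in Q) \bigcap_i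
    [set p : {ptws 'I_g -> Gamma} | closed_edge (tf.2 i) (p i)]).
  apply: closed_bigcup => [|tf _].
    exact: sub_finite_set (@subsetT _ _) (@finite_finset _ _).
  apply: closed_bigI => i _.
  rewrite (_ : [set p | _] = proj i @^-1` (closed_edge (tf.2 i)))//.
  apply: closed_comp; last exact: closed_closed_edge.
  by move=> p _; exact: proj_continuous.
apply/seteqP; split=> p.
  move=> [T [p' [Tst pe]]]; rewrite sum_notin => DE.
  have [f fT] := divisor_enumerates DE.
  (* Equal sums differ by a permutation [s], which is absorbed into the enumeration. *)
  have : sum_points (fun i => p' (f i)) = sum_points p.
    by apply: val_inj; exact: etrans (divisor_sum_points p' fT) (esym DE).
  move=> /sum_points_fibre[s pE].
  exists (T, [ffun i => f (s i)]) => [|i _] /=.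
    split=> //=; case: fT => finj fB; split=> [i j|e]; first by rewrite !ffunE => /finj/perm_inj.
    split=> [/fB[i <-]|[i <-]]; first by exists (s^-1%g i); rewrite ffunE permKV.
    by apply/fB; exists (s i); rewrite ffunE.
  rewrite ffunE pE /=; apply: pe; rewrite -finset.in_setC.
  by apply/fT.2; exists (s i).
move=> [[T f] /= [Tst fT] pf].
exists T, (fun e => if [pick i | f i == e] is Some i then p i else vtx (src e)).
have pick_f i : [pick j | f j == f i] = Some i.
  by case: pickP => [j /eqP/fT.1 ->//|/(_ i)]; rewrite eqxx.
split=> // [e|].
  by rewrite -finset.in_setC => /fT.2[i <-]; rewrite pick_f; exact: pf.
rewrite sum_notin (enumerates_sum _ fT) /divisor /=.
by apply: eq_bigr => i _; rewrite pick_f.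
Qed.

Lemma break_in_closure (D : Divplus Gamma g) : break_divisor (divisor D) ->
  closure [set D : Divplus Gamma g | universally_reduced g (divisor D)] D.
Proof.
move=> [G [T [p [[Tconn _] pe]]]]; rewrite sum_notin => DE.
have [f fT] := divisor_enumerates DE.
have fnT i : f i \notin T by rewrite -finset.in_setC; apply/fT.2; exists i.
pose u e := pos e (p e).
have uP e : e \notin T -> 0 <= u e <= len e /\ par e (u e) = p e.
  by move=> /pe[x xl xe]; apply: posP; exists x.
(* Each chip moves towards the midpoint of its edge, so it is inside the edge for [0 < t < 1]. *)
pose s t e := (1 - t) * u e + t * (len e / 2).
have s_bound t e : e \notin T -> 0 <= t <= 1 -> 0 <= s t e <= len e.
  move=> /uP[/andP[u0 ul] _] /andP[t0 t1]; have l0 := len_gt0 e.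
  by rewrite /s; apply/andP; split; nra.
pose phi t : {ptws 'I_g -> Gamma} := fun i => par (f i) (s t (f i)).
have phic : phi @ (0 : R)^'+ --> ((fun i => p (f i)) : {ptws 'I_g -> Gamma}).
  apply: ptws_cvg => i A /nbhs_mdist[r r0 rA]; apply/near_right0P.
  have [ub ue] := uP _ (fnT i); set e := f i in ub ue *.
  have l0 := len_gt0 e; pose r' := Num.min 1 (r / len e).
  have r'0 : 0 < r' by rewrite lt_min ltr01 divr_gt0.
  exists r' => // t t0; rewrite lt_min => /andP[t1 tr]; apply: rA.
  have tb : 0 <= t <= 1 by rewrite !ltW.
  rewrite -/e -ue; apply: le_lt_trans (mdist_par ub (s_bound _ _ (fnT i) tb)) _.
  have -> : u e - s t e = t * (u e - len e / 2) by rewrite /s; ring.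
  rewrite normrM gtr0_norm//; apply: le_lt_trans (_ : t * len e < r); last by rewrite -ltr_pdivlMr.
  rewrite ler_pM2l// ler_norml; case/andP: ub => h1 h2; apply/andP; split; lra.
have D0 : (D : effdiv Gamma g) = sum_points (fun i => p (f i)).
  by apply: val_inj; exact: etrans DE (esym (divisor_sum_points p fT)).
move=> B; rewrite nbhsE => -[O [oO OD] OB].
rewrite open_DivplusE in oO.
have /phic : nbhs ((fun i => p (f i)) : {ptws 'I_g -> Gamma}) [set p | O (sum_points p)].
  by apply: open_nbhs_nbhs; split=> //=; rewrite -D0.
move=> /near_right0P[r r0 rO]; pose t := Num.min 1 r / 2.
have m0 : 0 < Num.min 1 r by rewrite lt_min ltr01.
have [mr m1] : Num.min 1 r <= r /\ Num.min 1 r <= 1 by rewrite !ge_min !lexx orbT.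
have [t0 tr t1] : [/\ 0 < t, t < r & t < 1] by rewrite /t; split; lra.
have Ot := rO t t0 tr.
exists (sum_points (phi t)); split; last exact: OB.
have dE := @divisor_sum_points _ (~: T)%SET f (fun e => par e (s t e)) fT.
have /andP[effd /eqP degd] := svalP (sum_points (phi t)).
split=> // q; rewrite dE -sum_notin; apply: generic_q_reduced => // e eT.
have [/andP[u0 ul] _] := uP _ eT; have l0 := len_gt0 e.
by rewrite /s; apply/andP; split; nra.
Qed.

End SymmetricProduct.

Theorem theorem4p17 (R : realType) (Gamma : metricType R) (g : nat)
    (hGamma : metric_graph Gamma g) :
  [set D : Divplus Gamma g | break_divisor (divisor D)]
  = closure [set D : Divplus Gamma g | universally_reduced g (divisor D)].
Proof.
case: hGamma => G gG; apply/seteqP; split=> D; first exact: break_in_closure.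
move=> clD; suff [T [p TpD]] : break_of G (divisor D) by exists G, T, p.
(* Universally reduced divisors are break divisors of the one model [G], and these form a closed
   set. *)
apply: closed_break_of; apply: closureS clD => D' [degD' /fgposP effD' redD'].
by apply: reduced_break => //; rewrite gG.
Qed.
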